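(* Let $m\ge2$ and let $\mathcal{H}\in\mathcal{P}(\mathcal{H})$ be a connected unicyclic ($m$-uniform linear) hypergraph with $k$ edges whose cycle has length $l$. Suppose $(k-l-6)(m-1)\ge20$. Then: (i) If $\mathcal{H}\ne UC_l(c_1=k-l)$, then $\lambda_1(\mathcal{H})\le\lambda_1(UC_l(c_1=k-l-1,c_2=1))$, and equality holds only when $\mathcal{H}=UC_l(c_1=k-l-1,c_2=1)$. (ii) $\lambda_1(UC_l(c_1=k-l-1,c_2=1))<\dfrac{m+\sqrt{m^2+4(k-l+1)(m-1)}}{2m-2}$.
   Context: A hypergraph has a finite vertex set and an edge set of non-empty subsets of the vertex set; it is $m$-uniform if all edges have cardinality $m$, and linear if two distinct edges share at most one vertex. The adjacency matrix of a linear $m$-uniform hypergraph has $(i,j)$ entry $\frac{1}{m-1}$ if $i\ne j$ lie in a common edge, and $0$ otherwise; $\lambda_1$ denotes the spectral radius of this matrix. The $m$-th power hypergraph of a graph $G(V,E)$ is the $m$-uniform hypergraph obtained by adding to each edge $e\in E$ $m-2$ new vertices $v_{e,1},\dots,v_{e,m-2}$ (distinct for distinct edges). $\mathcal{P}(\mathcal{H})$ denotes the set of $m$-th power hypergraphs of graphs (this is a fixed notation for the set and does not depend on the particular hypergraph $\mathcal{H}$). A loose cycle of length $l\ge3$, $C_L(l)=v_1e_1v_2e_2\dots v_le_lv_1$, is the $m$-uniform hypergraph with edges $e_1,\dots,e_l$ in which $e_{i-1}\cap e_i=\{v_i\}$ (indices mod $l$, the $v_i$ distinct) and non-consecutive edges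 are disjoint; $v_1,\dots,v_l$ are its core vertices. A linear hypergraph is unicyclic if it contains exactly one loose cycle. Attaching a pendant edge at a vertex $v$ means adding a new edge consisting of $v$ and $m-1$ new vertices. $UC_l(c_1,\dots,c_l)$ is obtained from $C_L(l)$ by attaching $c_i$ pendant edges at $v_i$ for $i=1,\dots,l$; when only some of the $c_i$ are listed, the others are $0$. Equality of hypergraphs means isomorphism. *)

(* Defs.v *)
(* The real numbers are an arbitrary realType of MathComp-Analysis.
   classical_sets is imported first so that set0 etc. denote finite sets. *)
From HB Require Import structures.
From mathcomp Require Import classical_sets reals.
From mathcomp Require Import all_boot all_order all_algebra.
From mathcomp Require Import complex.

Set Implicit Arguments.
Unset Strict Implicit.
Unset Printing Implicit Defensive.

Import Order.TTheory GRing.Theory Num.Theory.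

Record hypergraph := Hypergraph {
  vertex :> finType;
  edges : {set {set vertex}};
  edges_nonempty : set0 \notin edges
}.

Definition huniform (m : nat) (H : hypergraph) : Prop :=
  forall e, e \in edges H -> #|e| = m.

Definition hlinear (H : hypergraph) : Prop :=
  forall e f, e \in edges H -> f \in edges H -> e != f -> #|e :&: f| <= 1.

Definition hiso (H H' : hypergraph) : Prop :=
  exists2 f : H -> H', bijective f & [set f @: e | e : {set H} in edges H] = edges H'.

Definition hadj (H : hypergraph) : rel H :=
  fun x y => (x != y) && [exists e in edges H, (x \in e) && (y \in e)].

Definition hconnected (H : hypergraph) : Prop :=
  forall x y : H, connect (@hadj H) x y.

(* The indices of v and e are cyclic: ord_pred i is i - 1 modulo l.  In
   v_1 e_1 v_2 e_2 ... v_l e_l v_1 the edge e_i contains v_i and v_(i+1). *)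
Definition loose_cycle_seq (H : hypergraph) (l : nat)
    (v : 'I_l -> H) (e : 'I_l -> {set H}) : Prop :=
  [/\ 3 <= l, injective v, injective e,
      forall i, e i \in edges H
    & (forall i, e (ord_pred i) :&: e i = [set v i]) /\
      (forall i j : 'I_l, i != j -> i != ord_pred j -> j != ord_pred i ->
         [disjoint e i & e j])].

(* A loose cycle contained in H is identified with its set of edges, so that
   rotating or reversing the cyclic sequence yields the same loose cycle. *)
Definition loose_cycle_of (H : hypergraph) (l : nat) (C : {set {set H}}) : Prop :=
  exists (v : 'I_l -> H) (e : 'I_l -> {set H}),
    loose_cycle_seq v e /\ C = [set e i | i : 'I_l].

Definition unicyclic (H : hypergraph) : Prop :=
  hlinear H /\
  exists! C : {set {set H}}, exists l : nat, loose_cycle_of l C.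

Section Power.
Variables (m : nat) (G : hypergraph).

(* inr (e, j) is the new vertex v_{e,j}. *)
Definition power_vertex : finType :=
  (G + {e : {set G} | e \in edges G} * 'I_(m - 2))%type.

Definition power_edge (e : {e : {set G} | e \in edges G}) : {set power_vertex} :=
  [set inl x | x in val e] :|: [set inr (e, j) | j : 'I_(m - 2)].

Lemma power_nonempty : set0 \notin [set power_edge e | e in setT].
Proof.
apply/imsetP => -[e _ /esym/eqP]; rewrite setU_eq0 imset_eq0 => /andP[/eqP e0 _].
by have := edges_nonempty G; rewrite -e0 (valP e).
Qed.

Definition power_hypergraph := Hypergraph power_nonempty.

End Power.

(* A (simple) graph is a 2-uniform hypergraph. *)
Definition is_power_hypergraph (m : nat) (H : hypergraph) : Prop :=
  exists G : hypergraph, huniform 2 G /\ hiso H (power_hypergraph m G).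

Section LooseCycle.
Variables (m l : nat).

(* inl i is the core vertex v_i; inr (i, j) are the m - 2 other vertices of
   the edge e_i, which contains v_i and v_(i+1). *)
Definition CL_vertex : finType := ('I_l + 'I_l * 'I_(m - 2))%type.

Definition CL_edge (i : 'I_l) : {set CL_vertex} :=
  [set inl i; inl (ordS i)] :|: [set inr (i, j) | j : 'I_(m - 2)].

Lemma CL_nonempty : set0 \notin [set CL_edge i | i in setT].
Proof.
by apply/imsetP => -[i _ /setP/(_ (inl i))]; rewrite !inE eqxx.
Qed.

Definition CL := Hypergraph CL_nonempty.

End LooseCycle.

Section Attach.
Variables (m : nat) (H : hypergraph) (c : H -> nat).

(* A pair p = (v, a) with a < c v names the a-th pendant edge attached at v;
   inr (p, j) are its m - 1 new vertices. *)
Definition pendant : finType := {v : H & 'I_(c v)}.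

Definition attach_vertex : finType := (H + pendant * 'I_(m - 1))%type.

Definition old_edge (e : {set H}) : {set attach_vertex} := [set inl x | x in e].

Definition pendant_edge (p : pendant) : {set attach_vertex} :=
  inl (tag p) |: [set inr (p, j) | j : 'I_(m - 1)].

Lemma attach_nonempty :
  set0 \notin [set old_edge e | e in edges H] :|: [set pendant_edge p | p in setT].
Proof.
rewrite inE negb_or; apply/andP; split; apply/imsetP.
  move=> -[e eH /esym/eqP]; rewrite imset_eq0 => /eqP e0.
  by have := edges_nonempty H; rewrite -e0 eH.
by move=> -[p _ /setP/(_ (inl (tag p)))]; rewrite !inE eqxx.
Qed.

Definition attach_pendants := Hypergraph attach_nonempty.

End Attach.

(* UC m l [:: c_1; ...; c_r]: unlisted c_i are 0. *)
Definition UC (m l : nat) (c : seq nat) : hypergraph :=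
  @attach_pendants m (CL m l) (fun x => if x is inl i then nth 0 c i else 0).

Local Open Scope ring_scope.

Definition spectral_radius (R : realType) (n : nat) (A : 'M[R]_n) : R :=
  sup [set r : R | exists2 z : R[i],
         eigenvalue (map_mx (real_complex R) A) z
       & r = ComplexField.Normc.normc z]%classic.

Definition adjacency_mx (R : realType) (m : nat) (H : hypergraph) : 'M[R]_#|H| :=
  \matrix_(i, j) if hadj (enum_val i) (enum_val j) then (m%:R - 1)^-1 else 0.

Definition lambda1 (R : realType) (m : nat) (H : hypergraph) : R :=
  spectral_radius (adjacency_mx R m H).

(* Main.v *)
Require Import Defs.
From mathcomp Require Import reals.
From mathcomp Require Import all_boot all_order all_algebra.
From mathcomp Require Import complex.
From mathcomp Require Import spectral sesquilinear.
From mathcomp Require Import ring lra zify.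

(* Let G be the unicyclic graph whose m-th power is H, and mu = (m-1) lambda_1.
   Eliminating the inner vertices of the edges from the eigenvalue equation
   shows that the Perron vector x of H, restricted to G, satisfies
   sum_(v ~ u) ((m-2) x_u + (mu+1) x_v) = mu (mu-m+3) x_u; moreover a graph on
   the same vertices whose quadratic form
   Q = sum_(uv edge) ((m-2)(x_u^2 + x_v^2) + 2 (mu+1) x_u x_v)
   is at least as large at x has a power with at least as large a spectral
   radius, strictly unless x solves its equation too.  So it suffices to
   rearrange the edges of G without decreasing Q.  Let u maximise x.  If u lies
   on the cycle, hang all off-cycle vertices on u except one, which goes to a
   cycle neighbour of u; before that, exchange a vertex, or reverse a segment of
   the cycle, if the parent of the exceptional vertex has the larger value.  If
   u is off the cycle, with root r, let u replace a cycle neighbour of r, which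
   becomes the exceptional vertex, pendant at r.
   The bound (ii) follows from a positive test vector taking three values. *)

(** Two powers have different inner vertices, so their matrices are not compared directly. The
    eliminated equation is kept at the value [mu] of H also for the rearranged graph: inner entries
    filled in for this value satisfy the eigenvalue equation exactly, and the Rayleigh defect lives
    on the vertices of G alone. For positive x each edge term of Q increases in both entries, so
    moving an edge end to a larger entry never hurts.

    A unicyclic graph is coded by a map f: every vertex v owns the edge {v, f v}, where f is the
    successor on the cycle and a parent elsewhere. Then Q is a sum over vertices, and rearranging
    edges means changing f.

    The equality case shapes the rearrangements. Q may stay constant although the graph changes;
    then some vertex is exhibited whose row sum strictly grows, so that x cannot solve both
    equations.

    In (ii), m-1 times the bound is the positive root c of c^2 = m c + (m-1) N with N = k-l+1, the
    degree of the hub in the extremal graph. The numerical hypothesis gives k >= l+7, hence N >= 8,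
    which leaves room for a strict test vector. *)

Set Implicit Arguments.
Unset Strict Implicit.
Unset Printing Implicit Defensive.

Import Order.TTheory GRing.Theory Num.Theory.
Local Open Scope ring_scope.

(** * Spectral radius of a nonnegative symmetric matrix *)

Lemma spectral_radius_attained (R : realType) n (A : 'M[R]_n) (a : R[i]) :
  eigenvalue (map_mx (real_complex R) A) a ->
  (forall b, eigenvalue (map_mx (real_complex R) A) b -> `|b| <= `|a|) ->
  (spectral_radius A)%:C%C = `|a|.
Proof.
move=> ea maxa; congr (_%:C)%C; apply/eqP; rewrite eq_le; apply/andP; split.
  apply: ge_sup; first by exists (ComplexField.Normc.normc a), a.
  by move=> _ [b eb ->]; have := maxa _ eb; rewrite lecR.
apply: ub_le_sup; last by exists a.
exists (ComplexField.Normc.normc a) => _ [b eb ->].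
by have := maxa _ eb; rewrite lecR.
Qed.

(** Perron-Frobenius without irreducibility. The entrywise moduli of an eigenvector for an
    eigenvalue of largest modulus have Rayleigh quotient at least [r], because [A] is nonnegative.
    The Rayleigh bound forces equality, and its equality case makes the vector of moduli an
    eigenvector. *)
Lemma spectral_radius_sym (R : realType) n (A : 'M[R]_n) (i0 : 'I_n) :
  (forall i j, 0 <= A i j) -> (forall i j, A i j = A j i) ->
  let r := spectral_radius A in
  (exists z : 'I_n -> R, [/\ forall i, 0 <= z i, exists i, z i != 0
     & forall j, \sum_i z i * A i j = r * z j]) /\
  forall z : 'I_n -> R,
    \sum_j (\sum_i z i * A i j) * z j <= r * \sum_j z j ^+ 2 /\
    (\sum_j (\sum_i z i * A i j) * z j = r * \sum_j z j ^+ 2 ->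
     forall j, \sum_i z i * A i j = r * z j).
Proof.
move=> A_ge0 A_sym r.
pose B := map_mx (real_complex R) A.
have Bherm : B \is hermsymmx.
  apply: realsym_hermsym.
    by apply/is_hermitianmxP; apply/matrixP => i j; rewrite expr0 scale1r !mxE A_sym.
  by apply/mxOverP => i j; rewrite !mxE complex_real.
have Bnorm := hermitian_normalmx Bherm.
have /orthomx_spectralP := Bnorm.
have /mxOverP := hermitian_spectral_diag_real Bherm.
have := spectral_unitarymx B.
set P := spectralmx B; set d := spectral_diag B => Pu d_real BE.
rewrite invmx_unitary // in BE.
have PPt : P *m (P^t* )%sesqui = 1%:M by apply/unitarymxP.
have PtP : (P^t* )%sesqui *m P = 1%:M by apply: mulmx1C.
(* [w v] lists the coordinates of [v] in the orthonormal eigenbasis formed by the rows of [P]. *)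
pose w (v : 'rV_n) := v *m (P^t* )%sesqui.
have wP v : v = w v *m P by rewrite /w -mulmxA PtP mulmx1.
have wB v : v *m B = w v *m diag_mx d *m P by rewrite BE !mulmxA.
have conjw v : (v ^t* )%sesqui = (P^t* )%sesqui *m ((w v)^t* )%sesqui.
  by rewrite {1}(wP v) trmx_mul map_mxM.
have formB v : (v *m B *m (v ^t* )%sesqui) 0 0 = \sum_i d 0 i * `|w v 0 i| ^+ 2.
  rewrite wB conjw mulmxA -(mulmxA _ P) PPt mulmx1 mxE; apply: eq_bigr => i _.
  by rewrite mul_mx_diag !mxE normCK mulrAC mulrC mulrA.
have form1 v : (v *m (v ^t* )%sesqui) 0 0 = \sum_i `|w v 0 i| ^+ 2.
  rewrite conjw {1}(wP v) mulmxA -(mulmxA _ P) PPt mulmx1 mxE.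
  by apply: eq_bigr => i _; rewrite !mxE normCK.
have wdiag v a : v *m B = a *: v -> forall i, d 0 i * w v 0 i = a * w v 0 i.
  move=> vB i; have : w v *m diag_mx d = a *: w v.
    have := congr1 (fun M => M *m (P^t* )%sesqui) vB.
    by rewrite wB -(mulmxA _ P) PPt mulmx1 -scalemxAl.
  by move=> /rowP/(_ i); rewrite mul_mx_diag !mxE mulrC.
(* The largest modulus may belong to a negative eigenvalue; that [r] itself is an eigenvalue only
   comes out at the end. *)
have [i1 [d_max]] : exists i1, (forall i, `|d 0 i| <= `|d 0 i1|)
    /\ eigenvalue B (d 0 i1).
  have [i1 _ d_max] :=
    arg_maxP (fun i => ComplexField.Normc.normc (d 0 i)) (isT : xpredT i0).
  exists i1; split=> [i|]; first by rewrite lecR; apply: d_max.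
  apply/eigenvalueP; exists (row i1 P).
    rewrite -row_mul {1}BE !mulmxA PPt mul1mx row_mul row_diag_mx -scalemxAl.
    by rewrite -rowE.
  apply/eqP => Pi1; have /rowP/(_ i1) := congr1 (row i1) PPt.
  by rewrite row_mul Pi1 mul0mx !mxE eqxx => /eqP; rewrite eq_sym oner_eq0.
move=> ed; have rE : (r%:C)%C = `|d 0 i1|.
  apply: spectral_radius_attained => // b /eigenvalueP[v vB v_neq0].
  have /rV0Pn[i wi] : w v != 0.
    by apply: contraNneq v_neq0 => w0; rewrite (wP v) w0 mul0mx.
  by have /(mulIf wi) <- := wdiag _ _ vB i.
have rayleigh z :
    \sum_j (\sum_i z i * A i j) * z j <= r * \sum_j z j ^+ 2 /\
    (\sum_j (\sum_i z i * A i j) * z j = r * \sum_j z j ^+ 2 ->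
     forall j, \sum_i z i * A i j = r * z j).
  pose v : 'rV[R[i]]_n := \row_j (z j)%:C%C.
  have vBE j : (v *m B) 0 j = ((\sum_i z i * A i j)%:C)%C.
    by rewrite mxE rmorph_sum; apply: eq_bigr => i _; rewrite !mxE rmorphM.
  have conjv j : (v ^t* )%sesqui j 0 = ((z j)%:C)%C.
    by rewrite !mxE conj_Creal // complex_real.
  have S1 : ((\sum_j (\sum_i z i * A i j) * z j)%:C)%C
      = \sum_i d 0 i * `|w v 0 i| ^+ 2.
    rewrite -formB mxE rmorph_sum; apply: eq_bigr => j _.
    by rewrite conjv vBE rmorphM.
  have S2 : ((\sum_j z j ^+ 2)%:C)%C = \sum_i `|w v 0 i| ^+ 2.
    rewrite -form1 mxE rmorph_sum; apply: eq_bigr => j _.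
    by rewrite conjv mxE rmorphXn expr2.
  have term_ge0 i : 0 <= (`|d 0 i1| - d 0 i) * `|w v 0 i| ^+ 2.
    rewrite mulr_ge0 ?exprn_ge0 // subr_ge0 (le_trans _ (d_max i)) //.
    exact: real_ler_norm.
  have gap : ((r * (\sum_j z j ^+ 2) - \sum_j (\sum_i z i * A i j) * z j)%:C)%C
      = \sum_i (`|d 0 i1| - d 0 i) * `|w v 0 i| ^+ 2.
    rewrite [LHS]rmorphB [X in X - _]rmorphM /= rE S1 S2 mulr_sumr -sumrB.
    by apply: eq_bigr => i _; rewrite mulrBl.
  split; first by rewrite -subr_ge0 -lecR gap sumr_ge0.
  move=> /esym/eqP; rewrite -subr_eq0 => /eqP zE.
  move: gap; rewrite zE => /esym/psumr_eq0P gap0.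
  (* Every nonnegative term of the gap vanishes, so each coordinate is zero or belongs to the
     eigenvalue [r]. *)
  have wE : w v *m diag_mx d = (r%:C)%C *: w v.
    apply/rowP => i; have /eqP := gap0 (fun i _ => term_ge0 i) i isT.
    rewrite mulf_eq0 subr_eq0 expf_eq0 normr_eq0 mul_mx_diag !mxE rE.
    by case/orP=> /eqP ->; rewrite ?mulr0 ?mul0r // mulrC.
  move=> j; have /rowP/(_ j) : v *m B = (r%:C)%C *: v.
    by rewrite wB wE -scalemxAl -wP.
  by rewrite vBE !mxE => /eqP; rewrite -rmorphM => /eqP/complexI.
split; last exact: rayleigh.
have [u uB u_neq0] := eigenvalueP ed.
pose z i := ComplexField.Normc.normc (u 0 i).
have zE i : ((z i)%:C)%C = `|u 0 i| by [].
have z_ge0 i : 0 <= z i by rewrite -lecR zE; apply: normr_ge0.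
exists z; split=> //.
  have /rV0Pn[i ui] := u_neq0; exists i; apply: contraNneq ui => zi.
  by rewrite -normr_eq0 -zE zi.
have [zle zeq] := rayleigh z; apply: zeq.
apply: le_anti; rewrite zle /= mulr_sumr ler_sum // => j _.
rewrite expr2 mulrA ler_wpM2r // -lecR [leLHS]rmorphM /= rE zE -normrM.
have -> : d 0 i1 * u 0 j = \sum_i u 0 i * B i j.
  by have /rowP/(_ j) := uB; rewrite !mxE => <-.
rewrite [leRHS]rmorph_sum (le_trans (ler_norm_sum _ _ _)) //= ler_sum // => i _.
by rewrite normrM [leRHS]rmorphM mxE /= zE [X in _ * X]ger0_norm // lecR.
Qed.

(** * The adjacency operator of a hypergraph *)

Lemma hadj_sym (H : hypergraph) : symmetric (@hadj H).
Proof.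
move=> x y; rewrite /hadj eq_sym; congr (_ && _).
by apply: eq_existsb => e; rewrite [(x \in e) && _]andbC.
Qed.

Definition adj_sum (R : realType) (H : hypergraph) (z : H -> R) (x : H) : R :=
  \sum_(y | hadj x y) z y.

Section Lambda1.
Variables (R : realType) (m : nat).
Hypothesis hm : (2 <= m)%N.

(** The factor m-1 clears the entries 1/(m-1) of the adjacency matrix: [mu] is the spectral radius
    of the plain neighbour sum [adj_sum]. *)
Definition mu (H : hypergraph) : R := (m%:R - 1) * lambda1 R m H.

Lemma m1_gt0 : 0 < m%:R - 1 :> R.
Proof. by rewrite subr_gt0 ltr1n. Qed.

Lemma mu_spectrum (H : hypergraph) (x0 : H) :
  (exists z : H -> R, [/\ forall x, 0 <= z x, exists x, z x != 0
     & forall x, adj_sum z x = mu H * z x]) /\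
  forall z : H -> R,
    \sum_x z x * adj_sum z x <= mu H * \sum_x z x ^+ 2 /\
    (\sum_x z x * adj_sum z x = mu H * \sum_x z x ^+ 2 ->
     forall x, adj_sum z x = mu H * z x).
Proof.
pose c : R := m%:R - 1; have c_gt0 : 0 < c := m1_gt0.
pose A := adjacency_mx R m H.
have sumA (z : H -> R) x :
    c * \sum_i z (enum_val i) * A i (enum_rank x) = adj_sum z x.
  rewrite /adj_sum [RHS](reindex_onto enum_val enum_rank) => /=; last first.
    by move=> y _; rewrite enum_rankK.
  rewrite mulr_sumr [RHS]big_mkcond; apply: eq_bigr => i _.
  rewrite enum_valK eqxx andbT mxE enum_rankK hadj_sym; case: ifP => _.
    by rewrite mulrC -mulrA mulVf ?mulr1 ?gt_eqF.
  by rewrite !mulr0.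
have [] := @spectral_radius_sym R _ A (enum_rank x0).
- by move=> i j; rewrite mxE; case: ifP; rewrite // invr_ge0 ltW.
- by move=> i j; rewrite !mxE hadj_sym.
move=> [z [z_ge0 [i zi] zE]] rayleigh; split.
  exists (z \o enum_rank); split=> [x|/=|x] //=.
    by exists (enum_val i); rewrite enum_valK.
  rewrite -sumA /mu -mulrA -zE; congr (_ * _).
  by apply: eq_bigr => j _; rewrite /= enum_valK.
move=> z'; pose w := z' \o @enum_val H predT.
have S2 : \sum_j w j ^+ 2 = \sum_x z' x ^+ 2.
  rewrite [RHS](reindex_onto enum_val enum_rank) => /=; last first.
    by move=> y _; rewrite enum_rankK.
  by apply: eq_big => [j|j _]; rewrite ?enum_valK ?eqxx.
have S1 : c * (\sum_j (\sum_i w i * A i j) * w j) = \sum_x z' x * adj_sum z' x.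
  rewrite [RHS](reindex_onto enum_val enum_rank) => /=; last first.
    by move=> y _; rewrite enum_rankK.
  rewrite mulr_sumr; apply: eq_big => [j|j _]; first by rewrite enum_valK eqxx.
  by rewrite -sumA enum_valK mulrA mulrC.
have [le_w eq_w] := rayleigh w.
rewrite -S1 -S2 /mu -/c -mulrA; split; first by rewrite ler_pM2l.
move=> /(mulfI (lt0r_neq0 c_gt0))/eq_w wE x.
have := wE (enum_rank x); rewrite /w /= enum_rankK => wx.
by rewrite -sumA -mulrA -wx.
Qed.

Lemma adj_sum_iso (H H' : hypergraph) (f : H -> H') (z : H' -> R) x :
  bijective f -> [set f @: e | e : {set H} in edges H] = edges H' ->
  adj_sum (z \o f) x = adj_sum z (f x).
Proof.
move=> fbij fE; have finj := bij_inj fbij.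
have adjE y : hadj (f x) (f y) = hadj x y.
  rewrite /hadj (inj_eq finj); congr (_ && _).
  apply/exists_inP/exists_inP => [[e']|[e eH /andP[xe ye]]].
    rewrite -fE => /imsetP[e eH ->]; rewrite !mem_imset // => ?.
    by exists e.
  by exists (f @: e); rewrite ?mem_imset // ?xe // -fE imset_f.
rewrite /adj_sum [RHS](reindex f) /=; last exact: onW_bij.
by apply: eq_bigl => y; rewrite adjE.
Qed.

(** The two matrices are indexed by unrelated enumerations. Instead of conjugating by a permutation,
    the nonnegative eigenvector of [H] is transported and used as a test vector on [H']. *)
Lemma lambda1_le_iso (H H' : hypergraph) :
  H -> hiso H H' -> lambda1 R m H <= lambda1 R m H'.
Proof.
move=> x0 [f fbij fE]; rewrite -(ler_pM2l m1_gt0) -/(mu H) -/(mu H').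
have [[z [z_ge0 [x zx] zE]] _] := mu_spectrum x0.
have [g fK gK] := fbij.
have zg : z =1 (z \o g) \o f by move=> y /=; rewrite fK.
have [+ _] := (mu_spectrum (f x0)).2 (z \o g).
rewrite (reindex f) /=; last exact: onW_bij.
rewrite [X in _ * X](reindex f) /=; last exact: onW_bij.
have -> : \sum_j z (g (f j)) * adj_sum (z \o g) (f j) = mu H * \sum_j z j ^+ 2.
  rewrite mulr_sumr; apply: eq_bigr => y _.
  rewrite -(adj_sum_iso (z \o g) y fbij fE) fK expr2 mulrCA -zE; congr (_ * _).
  by apply: eq_bigr => t _; rewrite /= fK.
have -> : \sum_j z (g (f j)) ^+ 2 = \sum_j z j ^+ 2.
  by apply: eq_bigr => y _; rewrite fK.
rewrite ler_pM2r // lt_def sumr_ge0 ?andbT // => [|y _]; last exact: sqr_ge0.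
apply: contra zx => /eqP z0; rewrite -sqrf_eq0; apply/eqP.
by move/psumr_eq0P : z0 => -> // y _; apply: sqr_ge0.
Qed.

(** Where [z] vanishes its neighbour sum vanishes too, hence so does each nonnegative term. Along
    paths this excludes all zeros in a connected hypergraph. *)
Lemma nonneg_eigen_zero_adj (H : hypergraph) (c : R) (z : H -> R) x y :
  (forall x, 0 <= z x) -> (forall x, adj_sum z x = c * z x) ->
  hadj x y -> z x = 0 -> z y = 0.
Proof.
move=> z_ge0 zE xy zx; have := zE x; rewrite zx mulr0.
by move/psumr_eq0P => ->.
Qed.

Lemma connected_eigen_gt0 (H : hypergraph) (c : R) (z : H -> R) :
  hconnected H -> (forall x, 0 <= z x) -> (exists x, z x != 0) ->
  (forall x, adj_sum z x = c * z x) -> forall x, 0 < z x.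
Proof.
move=> Hconn z_ge0 [y zy] zE x; rewrite lt_def z_ge0 andbT.
apply: contra zy => /eqP zx; have /connectP[p xp ->] := Hconn x y.
elim: p x zx xp => [|a p IH] x zx /=; first by rewrite zx.
by case/andP=> xa; apply: IH; apply: nonneg_eigen_zero_adj zx.
Qed.

End Lambda1.

Lemma hiso_sym (H H' : hypergraph) : hiso H H' -> hiso H' H.
Proof.
move=> [f [g fK gK] fE]; exists g; first by exists f.
rewrite -fE -imset_comp -[RHS]imset_id; apply: eq_imset => e /=.
by rewrite -imset_comp -[RHS]imset_id; apply: eq_imset => x /=; rewrite fK.
Qed.

Lemma hiso_trans (H H' H'' : hypergraph) : hiso H H' -> hiso H' H'' -> hiso H H''.
Proof.
move=> [f fbij fE] [g gbij gE]; exists (g \o f); first exact: bij_comp.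
rewrite -gE -fE -imset_comp; apply: eq_imset => e /=.
by rewrite imset_comp.
Qed.

Lemma lambda1_iso (R : realType) (m : nat) (H H' : hypergraph) :
  (2 <= m)%N -> H -> hiso H H' -> lambda1 R m H = lambda1 R m H'.
Proof.
move=> hm x HH'; apply: le_anti; rewrite lambda1_le_iso //=.
have [f _ _] := HH'; apply: lambda1_le_iso => //; first exact: f x.
exact: hiso_sym.
Qed.

(** * Power hypergraphs of graphs *)

Section PowerSpectrum.
Variables (R : realType) (m : nat) (G : hypergraph).
Hypotheses (hm : (2 <= m)%N) (G2 : huniform 2 G).

Local Notation P := (power_hypergraph m G).
Local Notation E := {e : {set G} | e \in edges G}.

Lemma graph_edgeE (e : {set G}) u : e \in edges G -> u \in e ->
  exists2 v, u != v & e = [set u; v].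
Proof.
move=> /G2/eqP/cards2P[a [b [ab ->]]]; rewrite !inE => /orP[]/eqP->.
  by exists b.
by exists a; rewrite 1?eq_sym // setUC.
Qed.

Lemma hadj_graph (u v : G) : hadj u v = ([set u; v] \in edges G).
Proof.
apply/andP/idP => [[uv /exists_inP[e eG /andP[ue ve]]]|uvG].
  have [w uw eE] := graph_edgeE eG ue; rewrite eE in eG ve.
  by move: ve uv; rewrite !inE => /orP[]/eqP-> //; rewrite eqxx.
split; last by apply/exists_inP; exists [set u; v]; rewrite // !inE !eqxx orbT.
by have /eqP := G2 uvG; apply: contraTneq => ->; rewrite setUid cards1.
Qed.

Lemma mem_power_edge_inl (e : E) x : (inl x \in power_edge m e) = (x \in val e).
Proof.
rewrite inE mem_imset; last exact: inl_inj.
by rewrite orbC; case: imsetP => // -[].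
Qed.

Lemma mem_power_edge_inr (e e' : E) (j : 'I_(m - 2)) :
  (inr (e', j) \in power_edge m e) = (e' == e).
Proof.
rewrite inE; case: imsetP => [[]//|_ /=].
by apply/imsetP/eqP => [[i _ [-> _]]|->] //; exists j.
Qed.

Lemma hadj_power_inl u v : @hadj P (inl u) (inl v) = hadj u v.
Proof.
rewrite /hadj; congr (_ && _); apply/exists_inP/exists_inP => -[e].
  case/imsetP=> f _ ->; rewrite !mem_power_edge_inl => ?.
  by exists (val f) => //; apply: valP.
move=> eG ?; exists (power_edge m (exist _ e eG)); first exact: imset_f.
by rewrite !mem_power_edge_inl.
Qed.

Lemma hadj_power_inr u (e : E) (j : 'I_(m - 2)) :
  @hadj P (inl u) (inr (e, j)) = (u \in val e).
Proof.
rewrite /hadj /=; apply/exists_inP/idP => [[f /imsetP[e' _ ->]]|ue].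
  by rewrite mem_power_edge_inl mem_power_edge_inr => /andP[ue /eqP->].
exists (power_edge m e); first exact: imset_f.
by rewrite mem_power_edge_inl mem_power_edge_inr ue eqxx.
Qed.

Lemma hadj_power_inner (e e' : E) (i j : 'I_(m - 2)) :
  @hadj P (inr (e, i)) (inr (e', j)) = (e == e') && (i != j).
Proof.
rewrite /hadj; apply/andP/andP => [[ne /exists_inP[f /imsetP[e'' _ ->]]]|].
  rewrite !mem_power_edge_inr => /andP[/eqP ee /eqP e'e].
  by rewrite ee e'e in ne *; split=> //; apply: contra ne => /eqP->.
case=> /eqP-> ij; split; first by apply: contra ij => /eqP[->].
apply/exists_inP; exists (power_edge m e'); first exact: imset_f.
by rewrite !mem_power_edge_inr eqxx.
Qed.

Lemma sum_incident_edges (g : {set G} -> R) u :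
  \sum_(e : E | u \in val e) g (val e) = \sum_(v | hadj u v) g [set u; v].
Proof.
rewrite -(big_sub_cond (fun e => e \in edges G) (fun e => u \in e) (fun e => g e)).
(* An edge at [u] is indexed by its other end. The default [u] of [odflt] is never reached for such
   an edge. *)
rewrite (reindex_onto (fun v => [set u; v])
  (fun e => odflt u [pick v | [set u; v] == e])) /=; last first.
  move=> e /andP[eG ue]; have [w uw ->] := graph_edgeE eG ue.
  by case: pickP => [v /eqP//|/(_ w)]; rewrite eqxx.
apply: eq_bigl => v; rewrite hadj_graph !inE eqxx andbT.
case: (boolP (_ \in edges G)) => //= uvG.
case: pickP => [w /eqP/setP uw|/(_ v)]; last by rewrite eqxx.
have := uvG; rewrite -hadj_graph => /andP[uv _].
have := uw v; rewrite !inE eqxx orbT eq_sym (negPf uv) /= => /eqP->.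
by rewrite eqxx.
Qed.

Lemma adj_sum_power_graph (z : P -> R) (Y : {set G} -> R) u :
  (forall e j, z (inr (e, j)) = Y (val e)) ->
  adj_sum z (inl u)
    = \sum_(v | hadj u v) (z (inl v) + (m - 2)%:R * Y [set u; v]).
Proof.
move=> zY; rewrite /adj_sum big_sumType /= big_split /=; congr (_ + _).
  by apply: eq_bigl => v; rewrite hadj_power_inl.
rewrite -(sum_incident_edges (fun e => (m - 2)%:R * Y e)).
transitivity (\sum_(e : E | u \in val e) \sum_j z (inr (e, j))).
  rewrite pair_big_dep /=; apply: eq_big => [[e j]|[e j] _] //.
  by rewrite hadj_power_inr andbT.
apply: eq_bigr => e _; rewrite (eq_bigr (fun=> Y (val e))) => [|j _] //.
by rewrite sumr_const card_ord mulr_natl.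
Qed.

Lemma adj_sum_power_inner (z : P -> R) (e : E) (j : 'I_(m - 2)) :
  adj_sum z (inr (e, j))
    = \sum_(a in val e) z (inl a) + \sum_i z (inr (e, i)) - z (inr (e, j)).
Proof.
rewrite /adj_sum big_sumType /= -addrA; congr (_ + _).
  by apply: eq_bigl => v; rewrite hadj_sym hadj_power_inr.
rewrite [X in _ = X - _](bigD1 j) //= [RHS]addrAC subrr add0r.
transitivity (\sum_(e' | e' == e) \sum_(i | i != j) z (inr (e', i))).
  rewrite pair_big_dep /=; apply: eq_big => [[e' i]|[e' i] _] //.
  by rewrite hadj_power_inner eq_sym [j == i]eq_sym.
by rewrite big_pred1_eq.
Qed.

Definition graph_row (c : R) (x : G -> R) (u : G) : R :=
  \sum_(v | hadj u v) ((m - 2)%:R * x u + (c + 1) * x v).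

(** An inner vertex of the edge uv sees u, v and m-3 inner vertices with its own value y. Solving c
    y = x_u + x_v + (m-3) y gives the denominator. *)
Definition power_ext (c : R) (x : G -> R) (y : P) : R :=
  match y with
  | inl u => x u
  | inr (e, _) => (\sum_(a in val e) x a) / (c + 1 - (m - 2)%:R)
  end.

Lemma power_ext_graph (c : R) (x : G -> R) u : c + 1 - (m - 2)%:R != 0 ->
  (c + 1 - (m - 2)%:R) * adj_sum (power_ext c x) (inl u) = graph_row c x u.
Proof.
move=> b0; set b := _ - _ in b0 *.
rewrite (adj_sum_power_graph u (Y := fun e => (\sum_(a in e) x a) / b)) //.
rewrite mulr_sumr; apply: eq_bigr => v /andP[uv _] /=.
rewrite big_setU1 ?inE // big_set1 /= /b; field.
exact: b0.
Qed.

Lemma power_ext_inner (c : R) (x : G -> R) p : c + 1 - (m - 2)%:R != 0 ->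
  adj_sum (power_ext c x) (inr p) = c * power_ext c x (inr p).
Proof.
case: p => e j b0; rewrite adj_sum_power_inner /= sumr_const card_ord -mulr_natl.
by field.
Qed.

(** Inner vertices satisfy the equation for [c] whatever [x] is, so they contribute nothing. Taking
    for [w] the extension itself gives a lower bound on [mu], taking an eigenvector gives an upper
    bound. *)
Lemma power_ext_form (c : R) (x : G -> R) (w : P -> R) :
  c + 1 - (m - 2)%:R != 0 ->
  \sum_y w y * adj_sum (power_ext c x) y - c * \sum_y w y * power_ext c x y
  = (\sum_u w (inl u) * (graph_row c x u - c * (c + 1 - (m - 2)%:R) * x u))
    / (c + 1 - (m - 2)%:R).
Proof.
move=> b0; rewrite mulr_sumr -sumrB big_sumType /= [X in _ + X]big1 => [|p _].
  rewrite addr0 mulr_suml; apply: eq_bigr => u _.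
  by rewrite -power_ext_graph //; field.
by rewrite power_ext_inner // mulrCA subrr.
Qed.

Lemma power_eigen_graph (c : R) (z : P -> R) :
  edges G != set0 -> (forall y, 0 < z y) -> (forall y, adj_sum z y = c * z y) ->
  [/\ 0 < c, 0 < c + 1 - (m - 2)%:R
    & forall u, graph_row c (z \o inl) u
        = c * (c + 1 - (m - 2)%:R) * z (inl u)].
Proof.
move=> /set0Pn[e0 e0G] z_gt0 zE; set b := _ - _.
have c_ge0 (y : P) : 0 <= c.
  by rewrite -(pmulr_lge0 _ (z_gt0 y)) -zE sumr_ge0 // => t _; apply: ltW.
have inner (e : E) (j : 'I_(m - 2)) : b * z (inr (e, j)) = \sum_(a in val e) z (inl a).
  (* Adding the vertex itself to its neighbours gives the whole edge, so the right side is the same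
     for all inner vertices of [e], and their entries agree. *)
  have zc k : (c + 1) * z (inr (e, k))
      = \sum_(a in val e) z (inl a) + \sum_i z (inr (e, i)).
    by rewrite mulrDl mul1r -zE adj_sum_power_inner subrK.
  have zk k : z (inr (e, k)) = z (inr (e, j)).
    have c1 : c + 1 != 0 by rewrite gt_eqF // ltr_wpDl // (c_ge0 (inr (e, j))).
    by apply: (mulfI c1); rewrite !zc.
  rewrite /b mulrBl zc; under [X in _ + X - _]eq_bigr do rewrite zk.
  by rewrite sumr_const card_ord -[X in _ + X - _]mulr_natl addrK.
have [u0 u0e] : exists u, u \in e0.
  by apply/set0Pn; apply: contraNneq (edges_nonempty G) => <-.
have [v0 uv0 e0E] := graph_edgeE e0G u0e.
have c_gt0 : 0 < c.
  rewrite -(pmulr_lgt0 _ (z_gt0 (inl u0))) -zE /adj_sum (bigD1 (inl v0)) /=.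
    by rewrite ltr_pwDl // sumr_ge0 // => t _; apply: ltW.
  by rewrite hadj_power_inl hadj_graph -e0E.
(* For m = 2 there are no inner vertices and b = c + 1; otherwise b times a positive inner entry is
   the positive sum over the ends of its edge. *)
have b_gt0 : 0 < b.
  have [m2|] := posnP (m - 2)%N; first by rewrite /b m2 subr0 ltr_wpDl // ltW.
  move=> m2; pose j := Ordinal m2; pose e : E := exist _ e0 e0G.
  rewrite -(pmulr_lgt0 _ (z_gt0 (inr (e, j)))) inner /= (bigD1 u0) //=.
  by rewrite ltr_pwDl // sumr_ge0 // => t _; apply: ltW.
have b0 : b != 0 by rewrite gt_eqF.
split=> // u; rewrite -power_ext_graph // -/b [c * b]mulrC -mulrA -zE.
congr (_ * _); apply: eq_bigr => -[v|[e j]] _ //=.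
by rewrite -(inner e j) -/b mulrC mulKf.
Qed.

(** Here [c] is meant to be the [mu] of another hypergraph. The extension of [x] has Rayleigh
    quotient at least [c]; if [c] is already the maximum, the extension is an eigenvector and [x]
    solves every row. *)
Lemma mu_power_ge (c : R) (x : G -> R) :
  0 < c + 1 - (m - 2)%:R -> (exists u, x u != 0) ->
  c * (c + 1 - (m - 2)%:R) * \sum_u x u ^+ 2 <= \sum_u x u * graph_row c x u ->
  c <= mu R m P /\
  (mu R m P = c -> forall u, graph_row c x u = c * (c + 1 - (m - 2)%:R) * x u).
Proof.
set b := _ - _ => b_gt0 [u0 xu0] xle; have b0 : b != 0 by rewrite gt_eqF.
pose z := power_ext c x.
have form := power_ext_form x z b0.
have form_ge0 : c * (\sum_y z y ^+ 2) <= \sum_y z y * adj_sum z y.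
  rewrite -subr_ge0; under [X in _ - c * X]eq_bigr do rewrite expr2.
  rewrite form divr_ge0 ?(ltW b_gt0) //.
  under eq_bigr => u _ do rewrite mulrBr mulrCA -expr2.
  by rewrite sumrB -mulr_sumr subr_ge0.
have [le_mu eq_mu] := (mu_spectrum R hm (inl u0 : P)).2 z.
have S_gt0 : 0 < \sum_y z y ^+ 2.
  rewrite lt_def sumr_ge0 ?andbT // => [|y _]; last exact: sqr_ge0.
  apply: contra xu0 => /eqP z0; rewrite -sqrf_eq0; apply/eqP.
  have zy0 := psumr_eq0P (fun y _ => sqr_ge0 (z y)) z0.
  exact: (zy0 (inl u0) isT).
have c_le : c <= mu R m P by rewrite -(ler_pM2r S_gt0) (le_trans form_ge0).
split=> // muE u; rewrite -power_ext_graph // eq_mu; last first.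
  by apply: le_anti; rewrite le_mu muE form_ge0.
by rewrite muE mulrCA mulrA.
Qed.

(** A positive strict supersolution bounds the spectral radius: pairing its extension z with a
    nonnegative eigenvector w, and moving the symmetric operator from w to z, gives mu <w, z> < c
    <w, z>. *)
Lemma mu_power_lt (c : R) (x : G -> R) (u0 : G) :
  0 < c + 1 - (m - 2)%:R -> (forall u, 0 < x u) ->
  (forall u, graph_row c x u < c * (c + 1 - (m - 2)%:R) * x u) ->
  mu R m P < c.
Proof.
set b := _ - _ => b_gt0 x_gt0 xlt; have b0 : b != 0 by rewrite gt_eqF.
have [[w [w_ge0 [y wy] wE]] _] := mu_spectrum R hm (inl u0 : P).
(* The strict inequalities live on the vertices of [G], so [w] must be nonzero there; an inner
   vertex passes its nonzero value on to an end of its edge. *)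
have [u wu] : exists u, w (inl u) != 0.
  case: y wy => [u|[e j]] wy; first by exists u.
  have [u ue] : exists u, u \in val e.
    by apply/set0Pn; apply: contraNneq (edges_nonempty G) => <-; apply: valP.
  exists u; apply: contra wy => /eqP wu; apply/eqP.
  by apply: (nonneg_eigen_zero_adj w_ge0 wE _ wu); rewrite hadj_power_inr.
pose z := power_ext c x.
have z_gt0 y' : 0 < z y'.
  case: y' => [//|[e j]]; rewrite /z /= divr_gt0 //.
  have [a ae] : exists a, a \in val e.
    by apply/set0Pn; apply: contraNneq (edges_nonempty G) => <-; apply: valP.
  by rewrite (bigD1 a) //= ltr_pwDl // sumr_ge0 // => t _; apply: ltW.
have S_gt0 : 0 < \sum_y w y * z y.
  rewrite (bigD1 (inl u)) //= ltr_pwDl ?mulr_gt0 // ?lt_def ?wu ?w_ge0 //.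
  by rewrite sumr_ge0 // => t _; rewrite mulr_ge0 // ltW.
rewrite -(ltr_pM2r S_gt0) -subr_lt0.
have -> : mu R m P * (\sum_y w y * z y) = \sum_y w y * adj_sum z y.
  rewrite mulr_sumr; transitivity (\sum_y adj_sum w y * z y).
    by apply: eq_bigr => t _; rewrite wE mulrA.
  under eq_bigr do rewrite mulr_suml big_mkcond /=.
  under [RHS]eq_bigr do rewrite mulr_sumr big_mkcond /=.
  rewrite exchange_big /=; apply: eq_bigr => t _; apply: eq_bigr => s _.
  by rewrite hadj_sym.
rewrite power_ext_form // pmulr_llt0 ?invr_gt0 // (bigD1 u) //=.
rewrite ltr_nwDl //.
  by rewrite pmulr_rlt0 ?subr_lt0 // lt_def wu w_ge0.
by rewrite sumr_le0 // => t _; rewrite mulr_ge0_le0 // subr_le0 ltW.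
Qed.

End PowerSpectrum.

(** * Graphs of functions *)

(** This is what makes the sets {v, f v} two-element and pairwise distinct, so that the graph is
    simple with one edge per vertex. *)
Definition no_short_cycle (V : finType) (f : V -> V) : Prop :=
  forall v, f v != v /\ f (f v) != v.

Lemma fun_graph_nonempty (V : finType) (f : V -> V) :
  set0 \notin [set [set v; f v] | v : V].
Proof. by apply/imsetP => -[v _ /setP/(_ v)]; rewrite !inE eqxx. Qed.

Definition fun_graph (V : finType) (f : V -> V) : hypergraph :=
  Hypergraph (fun_graph_nonempty f).

Section FunGraph.
Variables (G : hypergraph) (f : G -> G).
Hypothesis fns : no_short_cycle f.
Hypothesis GE : edges G = [set [set v; f v] | v : G].

Lemma fun_edge_in v : [set v; f v] \in edges G.
Proof. by rewrite GE; apply/imsetP; exists v. Qed.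

Lemma fun_edge_inj : injective (fun v => [set v; f v]).
Proof.
move=> u v uv; have /setP/(_ u) := uv; have /setP/(_ (f u)) := uv.
rewrite !inE !eqxx orbT /= => /esym fu /esym/orP[/eqP //|/eqP uE].
have [/negPf ff _] := fns (f v); have [_ /negPf ffv] := fns v.
by move: fu; rewrite uE ff ffv.
Qed.

Lemma fun_graph_uniform : huniform 2 G.
Proof.
move=> e; rewrite GE => /imsetP[v _ ->]; rewrite cards2 eq_sym.
by have [-> _] := fns v.
Qed.

Lemma hadj_fun u v : hadj u v = (f v == u) || (f u == v).
Proof.
rewrite hadj_graph ?GE; last exact: fun_graph_uniform.
apply/imsetP/orP => [[w _ /setP uv]|[/eqP<-|/eqP<-]]; last 2 first.
- by exists v; rewrite // setUC.
- by exists u.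
have := uv u; have := uv v; rewrite !inE !eqxx orbT /= => /esym vw /esym uw.
have := uv (f w); have := uv w; rewrite !inE !eqxx orbT /= => wuv fwuv.
have [/negPf fw _] := fns w.
case/orP: uw wuv fwuv => /eqP->; case/orP: vw => /eqP->.
- by rewrite fw.
- by right.
- by left.
- by rewrite eq_sym fw.
Qed.

Lemma sum_hadj_fun (R : nmodType) (g : G -> R) u :
  \sum_(v | hadj u v) g v = \sum_(v | f v == u) g v + g (f u).
Proof.
rewrite (bigD1 (f u)) /= ?hadj_fun ?eqxx ?orbT // addrC; congr (_ + _).
apply: eq_bigl => v; rewrite hadj_fun [v == f u]eq_sym.
case: (eqVneq (f u) v) => [<-|_]; last by rewrite orbF andbT.
by rewrite andbF; have [_ /negPf->] := fns u.
Qed.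

End FunGraph.

Section FunForm.
Variables (R : realType) (a b : R).

(** With a = m-2 and b = mu+1 this is the contribution of one edge to Q. *)
Definition edge_form (s t : R) : R := a * (s ^+ 2 + t ^+ 2) + 2 * b * s * t.

Lemma edge_formC s t : edge_form s t = edge_form t s.
Proof. by rewrite /edge_form; ring. Qed.

Definition fun_form (V : finType) (f : V -> V) (x : V -> R) : R :=
  \sum_v edge_form (x v) (x (f v)).

Definition fun_row (V : finType) (f : V -> V) (x : V -> R) (u : V) : R :=
  \sum_(v | f v == u) (a * x u + b * x v) + (a * x u + b * x (f u)).

(** The edge {v, f v} is seen from both ends: in the row of [f v] through a preimage, in the row of
    [v] through the image. *)
Lemma fun_formE (V : finType) (f : V -> V) (x : V -> R) :
  \sum_u x u * fun_row f x u = fun_form f x.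
Proof.
rewrite /fun_row; under eq_bigr do rewrite mulrDr mulr_sumr.
rewrite big_split /= (exchange_big_dep predT) //= -big_split /=.
apply: eq_bigr => v _; rewrite (big_pred1 (f v)) => [|u]; last exact: eq_sym.
rewrite /edge_form.
ring.
Qed.

End FunForm.

Lemma graph_row_fun (R : realType) (m : nat) (G : hypergraph) (f : G -> G) (c : R) x u :
  no_short_cycle f -> edges G = [set [set v; f v] | v : G] ->
  graph_row m c x u = fun_row (m - 2)%:R (c + 1) f x u.
Proof. by move=> fns GE; rewrite /graph_row (sum_hadj_fun fns GE). Qed.

(** * Rearranging the edges of a unicyclic graph *)

Section Next.
Variable V : eqType.
Implicit Types (s t : seq V) (u v : V).

Lemma map_next s : uniq s -> map (next s) s = rot 1 s.
Proof.
case: s => [//|a t] us; rewrite rot1_cons.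
apply: (@eq_from_nth _ a) => [|i]; first by rewrite size_map size_rcons.
rewrite size_map => i_lt; rewrite (nth_map a) // next_nth mem_nth // index_uniq //.
rewrite nth_rcons; move: i_lt; rewrite /= ltnS leq_eqVlt => /orP[/eqP->|i_lt].
  by rewrite ltnn eqxx nth_default.
by rewrite i_lt.
Qed.

Lemma next_head_eq u t v : uniq (u :: t) -> v \in u :: t ->
  next (u :: t) v = u -> v = last u t.
Proof.
move=> ut vt vu; rewrite -(prev_next ut v) vu prev_nth mem_head.
have /andP[/negPf u_t _] := ut.
by rewrite memNindex ?u_t //= -last_nth.
Qed.

Lemma next_last u t : uniq (u :: t) -> next (u :: t) (last u t) = u.
Proof.
move=> ut; rewrite next_nth mem_last; case/lastP: t ut => [|t v] ut; first by rewrite nth_nil.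
rewrite last_rcons; move: ut; rewrite -rcons_cons rcons_uniq => /andP[/negPf v_t _].
rewrite -(cats1 (u :: t)) index_cat v_t /= eqxx addn0 nth_default //.
by rewrite size_rcons.
Qed.

Lemma next_neq s v : uniq s -> (3 <= size s)%N -> v \in s ->
  next s v != v /\ next s (next s v) != v.
Proof.
move=> us s3 vs; have [i t st] := rot_to vs.
rewrite -!(next_rot i us) st.
have : uniq (v :: t) by rewrite -st rot_uniq.
have : (3 <= size (v :: t))%N by rewrite -st size_rot.
case: t {st} => [|b [|c t]] //= _; rewrite !inE !negb_or !eqxx.
by case/and3P=> /and3P[/negPf vb /negPf vc _] _ _; rewrite eq_sym vb eq_sym vc.
Qed.

End Next.

Definition cycle_fun (V : eqType) (s : seq V) (par : V -> V) (v : V) : V :=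
  if v \in s then next s v else par v.

(** The Boolean serves as a position in [s]: ordinary vertices hang at entry 0, the hub, and the
    exceptional [w] at entry 1, a cycle neighbour of the hub. *)
Definition star_par (V : eqType) (s : seq V) (w v : V) : V :=
  nth v s (v == w).

Definition star_fun (V : eqType) (s : seq V) (w : V) : V -> V :=
  cycle_fun s (star_par s w).

(** Maps are too fine an invariant: reversing the cycle passes the edge {v, next v} from v to next v
    and leaves the graph unchanged. *)
Definition same_graph (V : finType) (f g : V -> V) : Prop :=
  [set [set v; f v] | v : V] = [set [set v; g v] | v : V].

(** The rank [d] decreases along parents and so encodes that there is no cycle off [s]. *)
Lemma cycle_fun_no_short (V : finType) (s : seq V) (par : V -> V) (d : V -> nat) :
  uniq s -> (3 <= size s)%N -> (forall v, v \notin s -> (d (par v) < d v)%N) ->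
  no_short_cycle (cycle_fun s par).
Proof.
move=> us s3 dec v; rewrite /cycle_fun; case: ifPn => vs.
  by rewrite mem_next vs; apply: next_neq.
have dv := dec _ vs; split; first by apply: contraTneq dv => ->; rewrite ltnn.
case: ifPn => pv; first by apply: contraNneq vs => <-; rewrite mem_next.
have := ltn_trans (dec _ pv) dv.
by apply: contraTneq => ->; rewrite ltnn.
Qed.

Lemma star_no_short (V : finType) (s : seq V) (w : V) :
  uniq s -> (3 <= size s)%N -> no_short_cycle (star_fun s w).
Proof.
move=> us s3; apply: (@cycle_fun_no_short _ _ _ (fun v => v \notin s : nat)) => //.
move=> v vs; rewrite vs (_ : star_par s w v \in s) //.
by rewrite mem_nth // (leq_ltn_trans (leq_b1 _)) // (leq_trans _ s3).
Qed.

Lemma cycle_fun_rot (V : finType) (s : seq V) (par : V -> V) n : uniq s ->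
  cycle_fun (rot n s) par =1 cycle_fun s par.
Proof. by move=> us v; rewrite /cycle_fun mem_rot next_rot. Qed.

Lemma same_graph_ext (V : finType) (f g : V -> V) : f =1 g -> same_graph f g.
Proof. by move=> fg; apply: eq_imset => v; rewrite fg. Qed.

Lemma same_graph_rev (V : finType) (s : seq V) (par : V -> V) : uniq s ->
  same_graph (cycle_fun s par) (cycle_fun (rev s) par).
Proof.
move=> us; apply/setP => e; apply/imsetP/imsetP => -[v _ ->].
  case: (boolP (v \in s)) => vs; last by exists v; rewrite // /cycle_fun mem_rev (negPf vs).
  exists (next s v); rewrite // /cycle_fun mem_rev mem_next vs next_rev //.
  by rewrite prev_next // setUC.
case: (boolP (v \in s)) => vs; last by exists v; rewrite // /cycle_fun mem_rev (negPf vs).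
exists (prev s v); rewrite // /cycle_fun mem_rev mem_prev vs next_rev //.
by rewrite next_prev // setUC.
Qed.

(** * Exchange inequalities for the quadratic form at a positive vector *)

Section Forms.
Variables (R : realType) (a b : R) (V : finType).
Hypotheses (a_ge0 : 0 <= a) (b_gt0 : 0 < b).
Variable x : V -> R.
Hypothesis x_gt0 : forall v, 0 < x v.

Local Notation phi u v := (edge_form a b (x u) (x v)).

Lemma same_graph_row (f g : V -> V) : no_short_cycle f -> no_short_cycle g ->
  same_graph f g -> fun_row a b f x =1 fun_row a b g x.
Proof.
move=> fns gns fg u; rewrite /fun_row.
rewrite -(sum_hadj_fun (G := fun_graph f) fns erefl (fun v => a * x u + b * x v)).
by rewrite -(sum_hadj_fun (G := fun_graph f) gns fg (fun v => a * x u + b * x v)).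
Qed.

Lemma same_graph_form (f g : V -> V) : no_short_cycle f -> no_short_cycle g ->
  same_graph f g -> fun_form a b f x = fun_form a b g x.
Proof.
move=> fns gns fg; rewrite -!fun_formE.
by apply: eq_bigr => u _; rewrite (same_graph_row fns gns fg).
Qed.

Lemma edge_form_le u v w : x v <= x w -> phi u v <= phi u w.
Proof.
move=> vw; have := x_gt0 u; have := x_gt0 v => xv xu; rewrite /edge_form.
rewrite lerD ?ler_wpM2l ?mulr_ge0 ?(ltW xu) ?(ltW b_gt0) //.
by rewrite lerD2l lerXn2r ?nnegrE ?(ltW (x_gt0 _)).
Qed.

Lemma edge_form_lt u v w : x v < x w -> phi u v < phi u w.
Proof.
move=> vw; have := x_gt0 u; have := x_gt0 v => xv xu; rewrite /edge_form.
rewrite ler_ltD // ?ltr_pM2l ?mulr_gt0 ?ltr0n //.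
by rewrite ler_wpM2l // lerD2l lerXn2r ?nnegrE ?(ltW (x_gt0 _)) ?ltW.
Qed.

(** Each of the four vertices occurs once on either side, so the squares cancel and a product of two
    differences remains. *)
Lemma edge_form_swap u v w y : x y <= x u -> x v <= x w ->
  phi u v + phi w y <= phi u w + phi v y.
Proof.
move=> yu vw; rewrite -subr_ge0.
have -> : phi u w + phi v y - (phi u v + phi w y)
    = 2 * b * ((x u - x y) * (x w - x v)) by rewrite /edge_form; ring.
by rewrite !mulr_ge0 ?subr_ge0 // ltW.
Qed.

Fixpoint walk_form (u : V) (s : seq V) : R :=
  if s is v :: t then phi u v + walk_form v t else 0.

Lemma walk_form_cat u s t :
  walk_form u (s ++ t) = walk_form u s + walk_form (last u s) t.
Proof. by elim: s u => [|v s IH] u /=; rewrite ?add0r // IH addrA. Qed.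

Lemma walk_form_rev u s v :
  walk_form u (rcons s v) = walk_form v (rcons (rev s) u).
Proof.
elim: s u v => [|w s IH] u v /=; first by rewrite edge_formC.
rewrite IH rev_cons -!cats1 !walk_form_cat /= cats1 last_rcons.
by rewrite [X in X + _]edge_formC !addr0 addrC.
Qed.

Lemma cycle_form u t par : uniq (u :: t) ->
  fun_form a b (cycle_fun (u :: t) par) x
  = walk_form u (rcons t u) + \sum_(v | v \notin u :: t) phi v (par v).
Proof.
move=> us; rewrite /fun_form (bigID (mem (u :: t))) /=; congr (_ + _); last first.
  by apply: eq_bigr => v /negPf vs; rewrite /cycle_fun vs.
rewrite -big_uniq //=; set s := u :: t in us *.
transitivity (\sum_(p <- zip s (map (next s) s)) phi p.1 p.2).
  rewrite -[in zip s](map_id s) zip_map big_map !big_seq.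
  by apply: eq_bigr => v; rewrite /cycle_fun => ->.
(* The induction moves the start of the walk while its end stays at [u]. *)
rewrite map_next // rot1_cons /s {us s}.
elim: t {1 3}u => [|v t IH] u0; first by rewrite /= big_cons big_nil.
by rewrite /= big_cons /= IH.
Qed.

(** All terms of a row are positive, so a new preimage or a larger image raises it. This detects
    changes that the quadratic form may miss. *)
Lemma fun_row_lt (f g : V -> V) y :
  (forall v, f v = y -> g v = y) -> x (f y) <= x (g y) ->
  (x (f y) < x (g y) \/ exists2 v, g v = y & f v != y) ->
  fun_row a b f x y < fun_row a b g x y.
Proof.
move=> fg xy strict; have psi_gt0 u v : 0 < a * x u + b * x v.
  by rewrite ltr_wpDl ?mulr_gt0 // mulr_ge0 // ltW.
have sum_le : \sum_(v | f v == y) (a * x y + b * x v)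
    <= \sum_(v | g v == y) (a * x y + b * x v).
  rewrite big_mkcond [leRHS]big_mkcond ler_sum // => v _.
  case: eqP => [/fg->|_]; first by rewrite eqxx.
  by case: ifP => // _; apply: ltW.
have last_le : a * x y + b * x (f y) <= a * x y + b * x (g y).
  by rewrite lerD2l ler_pM2l.
case: strict => [xlt|[v gv fv]]; first by rewrite ler_ltD // ltrD2l ltr_pM2l.
rewrite ltr_leD // big_mkcond [ltRHS]big_mkcond (bigD1 v) // [ltRHS](bigD1 v) //=.
rewrite (negPf fv) gv eqxx ltr_leD // ler_sum // => w _.
case: eqP => [/fg->|_]; first by rewrite eqxx.
by case: ifP => // _; apply: ltW.
Qed.

(** The last clause is tailored to the equality case: if [x] solves the equations of both graphs,
    forms and rows agree, and only the third alternative is left. *)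
Definition improved (f : V -> V) (l : nat) : Prop := exists (s : seq V) (w : V),
  [/\ uniq s, size s = l, w \notin s,
      fun_form a b f x <= fun_form a b (star_fun s w) x
    & [\/ fun_form a b f x < fun_form a b (star_fun s w) x,
          exists y, fun_row a b f x y < fun_row a b (star_fun s w) x y
        | same_graph f (star_fun s w)]].

Lemma improved_same (f g : V -> V) l : no_short_cycle f -> no_short_cycle g ->
  same_graph f g -> improved g l -> improved f l.
Proof.
move=> fns gns fg [s [w [us sl ws le_form H]]]; exists s, w.
rewrite (same_graph_form fns gns fg); split=> //.
case: H => [?|[y ?]|gs]; [exact: Or31|apply: Or32|apply: Or33].
  by exists y; rewrite (same_graph_row fns gns fg).
by rewrite /same_graph fg.
Qed.

Section HubOnCycle.
Variables (u c1 : V) (t : seq V) (par : V -> V).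
Local Notation s := [:: u, c1 & t].
Hypothesis us : uniq s.
Hypothesis umax : forall v, x v <= x u.

Lemma improve_same_cycle w : w \notin s -> x (par w) <= x c1 ->
  fun_form a b (cycle_fun s par) x <= fun_form a b (star_fun s w) x.
Proof.
move=> ws parw; rewrite /star_fun !cycle_form // lerD2l ler_sum // => v vs.
rewrite /star_par; case: eqVneq => [->|_] /=; apply: edge_form_le => //.
Qed.

(** [w] keeps its parent [c1] and the others move to the hub. Either nothing has moved, or some
    vertex newly joins [u] and the row of [u] grows. *)
Lemma improve_child w : w \notin s -> par w = c1 ->
  improved (cycle_fun s par) (size s).
Proof.
move=> ws parw; exists s, w; split=> //.
  by apply: improve_same_cycle => //; rewrite parw.
case: (boolP [forall v, (v \notin s) ==> (v != w) ==> (par v == u)]).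
  move/forallP => par_u; apply: Or33; apply: same_graph_ext => v.
  rewrite /star_fun /cycle_fun; case: ifPn => // vs; rewrite /star_par.
  case: eqVneq => [->//|vw] /=.
  by have := par_u v; rewrite vs vw /= => /eqP.
case/forallPn => v; rewrite !negb_imply => /and3P[vs vw pv].
apply: Or32; exists u; apply: fun_row_lt => //.
- move=> y; rewrite /star_fun /cycle_fun; case: ifP => // _ py.
  rewrite /star_par; case: eqVneq => // yw; move: us; rewrite yw parw in py.
  by rewrite py /= mem_head.
- by rewrite /star_fun /cycle_fun mem_head.
right; exists v; rewrite /star_fun /cycle_fun (negPf vs) //.
by rewrite /star_par (negPf vw).
Qed.

(** Since nothing hung at [c1] before, its row gains [w] and loses nothing. *)
Lemma improve_redirect w : (forall v, v \notin s -> par v != c1) ->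
  w \notin s -> x (par w) <= x c1 -> improved (cycle_fun s par) (size s).
Proof.
move=> no_child ws parw; exists s, w; split=> //; first exact: improve_same_cycle.
apply: Or32; exists c1; have c1s : c1 \in s by rewrite !inE eqxx orbT.
apply: fun_row_lt => [v| |].
- rewrite /star_fun /cycle_fun; case: ifPn => // /no_child /eqP //.
- by rewrite /star_fun /cycle_fun c1s.
right; exists w; rewrite /star_fun /cycle_fun (negPf ws) ?no_child //.
by rewrite /star_par eqxx.
Qed.

End HubOnCycle.

(* The 2-opt exchange: reversing the segment from [c1] to [c] makes [c] a
   neighbour of the hub [u]. *)
Lemma improve_reverse u c1 t1 c t2 par w :
  let s := [:: u, c1 & t1 ++ c :: t2] in
  uniq s -> (forall v, x v <= x u) -> w \notin s -> par w = c -> t2 != [::] ->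
  x c1 < x c -> improved (cycle_fun s par) (size s).
Proof.
move=> s us umax ws parw t20 x1c.
pose s' := [:: u, c & rev t1 ++ c1 :: t2].
have ss' : perm_eq s s'.
  by apply/permP => p; rewrite /= !count_cat /= count_rev; lia.
have us' : uniq s' by rewrite -(perm_uniq ss').
have mem_s' : s' =i s by move=> v; rewrite (perm_mem ss').
have last_s : last u (c1 :: t1 ++ c :: t2) = last u (c :: rev t1 ++ c1 :: t2).
  by case: (t2) t20 => // e t3 _; rewrite !(last_cat, last_cons).
exists s', w; split=> //; first by rewrite (perm_size ss').
- by rewrite mem_s'.
- rewrite /star_fun !cycle_form //; apply: lerD; last first.
    rewrite [leRHS](eq_bigl _ _ (fun v => congr1 negb (mem_s' v))).
    apply: ler_sum => v vs; apply: edge_form_le; rewrite /star_par.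
    by case: eqVneq => [->|_] //=; rewrite parw.
  case: t2 t20 {s s' us ws ss' us' mem_s' last_s} => // e t2 _ /=.
  rewrite !rcons_cat /= !walk_form_cat /=.
  (* The reversed segment keeps its form; only the edges u c1 and c e are exchanged for u c and c1
     e. *)
  have rev1 := walk_form_rev c1 t1 c.
  rewrite -!cats1 !walk_form_cat /= !addr0 in rev1.
  have := edge_form_swap (umax e) (ltW x1c).
  move: rev1; set p := phi _ _; set q := phi _ _; lra.
(* As [t2] is nonempty, the cycle predecessor of [u] stays the same, while its successor rises from
   [c1] to [c]. *)
apply: Or32; exists u; apply: fun_row_lt.
- move=> v; rewrite /star_fun /cycle_fun mem_s'; case: ifP => vs.
    by move/(next_head_eq us vs) => ->; rewrite last_s; apply: next_last.
  rewrite /star_par; case: eqVneq => // -> pw; move: us.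
  by rewrite /s -pw parw /= !(inE, mem_cat) eqxx !orbT.
- by rewrite /star_fun /cycle_fun !mem_head /= !eqxx ltW.
by left; rewrite /star_fun /cycle_fun !mem_head /= !eqxx.
Qed.

(** [b'] takes the place of [c1] on the cycle and [c1] becomes a leaf at the hub. The edge u c1
    survives as a leaf edge, the edge from [b'] to its parent pays for u b', and replacing c1 c2 by
    b' c2 is the strict gain. *)
Lemma improve_swap u c1 c2 t par w b' :
  let s := [:: u, c1, c2 & t] in
  uniq s -> (forall v, x v <= x u) -> w \notin s -> b' \notin s -> w != b' ->
  par w = b' -> x c1 < x b' -> improved (cycle_fun s par) (size s).
Proof.
move=> s us umax ws bs wb parw x1b.
pose s' := [:: u, b', c2 & t].
have bs' : (b' == u = false) * (b' == c1 = false) * (b' == c2 = false) * (b' \in t = false).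
  by move: bs; rewrite !inE !negb_or => /and4P[/negPf-> /negPf-> /negPf-> /negPf->].
have us' : uniq s'.
  move: us; rewrite /= !inE !negb_or !bs' ![_ == b']eq_sym !bs' /=.
  by case/and4P=> /and3P[_ -> ->] _ -> ->.
have ws' : w \notin s'.
  by move: ws; rewrite !inE !negb_or wb => /and4P[-> _ -> ->].
have c1s' : c1 \notin s'.
  move: us; rewrite /= !inE !negb_or => /and4P[/and3P[]].
  by rewrite ![c1 == _]eq_sym bs' => -> _ _ /andP[] + -> _ _; rewrite eq_sym => ->.
have c1w : c1 != w by apply: contraNneq ws => <-; rewrite !inE eqxx orbT.
exists s', w.
suff form_lt : fun_form a b (cycle_fun s par) x < fun_form a b (star_fun s' w) x.
  by split=> //; [apply: ltW | apply: Or31].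
rewrite /star_fun !cycle_form // (bigD1 b') // [in ltRHS](bigD1 c1) //=.
have rest : \sum_(v | (v \notin s) && (v != b')) phi v (par v)
    <= \sum_(v | (v \notin s') && (v != c1)) phi v (star_par s' w v).
  rewrite [leRHS](eq_bigl (fun v => (v \notin s) && (v != b'))) => [|v]; last first.
    rewrite !inE !negb_or.
    by case: (v == u); case: (v == c1); case: (v == b'); rewrite //= !andbF.
  apply: ler_sum => v _; apply: edge_form_le; rewrite /star_par.
  by case: eqVneq => [->|_] //=; rewrite parw.
have hub_c1 : phi c1 (star_par s' w c1) = phi u c1.
  by rewrite /star_par (negPf c1w) /= edge_formC.
have b_le : phi b' (par b') <= phi u b'.
  by rewrite [leRHS]edge_formC; apply: edge_form_le.
have c_lt : phi c1 c2 < phi b' c2.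
  by rewrite edge_formC [ltRHS]edge_formC; apply: edge_form_lt.
move: rest; rewrite -/s -/s' hub_c1; move: b_le c_lt; lra.
Qed.

(** A child of [c1], if there is one, becomes the exceptional vertex. Otherwise [w0] does, and what
    matters is its parent: not above [c1] (redirect), above it and off the cycle (swap), or above it
    and on the cycle (reverse). *)
Lemma improve_cycle_hub u c1 t par (d : V -> nat) :
  let s := [:: u, c1 & t] in
  uniq s -> (3 <= size s)%N -> (forall v, v \notin s -> (d (par v) < d v)%N) ->
  (forall v, x v <= x u) -> x (last c1 t) <= x c1 ->
  (exists2 w, w \notin s & par w != u) ->
  improved (cycle_fun s par) (size s).
Proof.
move=> s us s3 dec umax last_le [w0 w0s parw0].
case: (boolP [exists v, (v \notin s) && (par v == c1)]).
  by case/existsP=> w /andP[ws /eqP parw]; apply: (improve_child us umax ws).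
move/existsPn => no_child.
have {}no_child v : v \notin s -> par v != c1.
  by move=> vs; have := no_child v; rewrite vs.
case: (lerP (x (par w0)) (x c1)) => [le_c1|lt_c1].
  exact: (improve_redirect us umax no_child w0s).
case: (boolP (par w0 \in s)) => ps; last first.
  case: t @s us s3 dec last_le w0s no_child ps => [|c2 t] s us s3 dec _ w0s no_child ps.
    by [].
  apply: (improve_swap us umax w0s ps _ erefl lt_c1).
  by have := dec _ w0s; apply: contraTneq => <-; rewrite ltnn.
have pt : par w0 \in t.
  by move: ps; rewrite !inE (negPf parw0) (negPf (no_child _ w0s)).
case/splitPr def_t : _ / pt => [t1 t2]; rewrite /s def_t in us w0s last_le *.
apply: (improve_reverse us umax w0s erefl _ lt_c1).
(* [c1] is the larger cycle neighbour of [u], so the parent, being larger still, is not the last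
   vertex of the cycle. *)
by case: t2 last_le {def_t us w0s} => //; rewrite last_cat /= leNgt lt_c1.
Qed.

(* Rerouting every vertex to the maximum [u] can only help; the edge freed at
   [u] itself pays for the last edge of the path from [u] to its root. *)
Lemma reroute_to_max (s : seq V) par (d : V -> nat) u :
  (forall v, v \notin s -> (d (par v) < d v)%N) -> (forall v, x v <= x u) ->
  u \notin s ->
  exists2 r, r \in s & \sum_(v | v \notin s) phi v (par v)
    <= \sum_(v | (v \notin s) && (v != u)) phi v u + phi u r.
Proof.
move=> dec umax us.
(* [v0] runs along the path from [u] to the cycle, and [T] holds the vertices still to be accounted
   for. The edge from [v0] to its parent is at most the edge from [u] to that parent, which is the
   rerouted edge of the parent, or the final edge to [r] once the cycle is reached. *)
suff step n v0 (T : {set V}) : (d v0 < n)%N -> v0 \in T ->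
    [disjoint T & s] -> (forall v, v \notin s -> (d v < d v0)%N -> v \in T) ->
    exists2 r, r \in s &
      \sum_(v in T) phi v (par v) <= \sum_(v in T :\ v0) phi v u + phi u r.
  have [||||r rs le_r] := step (d u).+1 u [set v | v \notin s] => //.
  - by rewrite inE.
  - by rewrite disjoint_subset; apply/subsetP => v; rewrite !inE.
  - by move=> v vs _; rewrite inE.
  exists r => //; move: le_r; rewrite (eq_bigl (fun v => v \notin s)) => [|v].
    move=> le_r; apply: (le_trans le_r); rewrite lerD2r le_eqVlt; apply/orP; left.
    by apply/eqP/eq_bigl => v; rewrite !inE andbC.
  by rewrite inE.
elim: n v0 T => [//|n IH] v0 T; rewrite ltnS => dn v0T Ts low.
have v0s : v0 \notin s by have /disjointFr -> := Ts.
rewrite (big_setD1 v0) //=; have dv0 := dec _ v0s.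
have le0 : phi v0 (par v0) <= phi u (par v0).
  by rewrite edge_formC [leRHS]edge_formC; apply: edge_form_le.
case: (boolP (par v0 \in s)) => ps.
  exists (par v0) => //; rewrite addrC lerD // ler_sum // => v _.
  exact: edge_form_le.
have [||||r rs le_r] := IH (par v0) (T :\ v0).
- exact: leq_trans dv0 dn.
- rewrite !inE low // andbT; apply: contraTneq dv0 => ->; by rewrite ltnn.
- by apply: disjointWl Ts; apply: subsetDl.
- move=> v vs dv; rewrite !inE low ?(ltn_trans dv) // andbT.
  by apply: contraTneq (ltn_trans dv dv0) => ->; rewrite ltnn.
exists r => //; apply: le_trans (lerD le0 le_r) _.
rewrite addrA lerD2r [leRHS](big_setD1 (par v0)) /=; last first.
  rewrite !inE low // andbT; apply: contraTneq dv0 => ->; by rewrite ltnn.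
by rewrite lerD2r edge_formC.
Qed.

(** The cycle edge c0 r survives as the pendant edge of [c0], and the edge u r left by the rerouting
    becomes a cycle edge. Only the edge closing the cycle changes, its end moving from [c0] to the
    strictly larger [u]. *)
Lemma improve_tree_hub c0 r t par u :
  let s := [:: c0, r & t] in
  uniq s -> (3 <= size s)%N -> (forall v, v \in s -> x v < x u) ->
  \sum_(v | v \notin s) phi v (par v)
    <= \sum_(v | (v \notin s) && (v != u)) phi v u + phi u r ->
  improved (cycle_fun s par) (size s).
Proof.
move=> s us s3 umax le_r.
have u_s : u \notin s by apply/negP => /umax; rewrite ltxx.
pose s' := [:: u, r & t].
have us' : uniq s'.
  move: us u_s => /= /andP[_ ->]; rewrite !inE !negb_or => /and3P[_ -> ->] //.
have c0s' : c0 \notin s'.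
  move: us u_s; rewrite /= !inE !negb_or => /and3P[/andP[-> ->] _ _] /and3P[+ _ _].
  by rewrite eq_sym => ->.
exists s', c0.
suff form_lt : fun_form a b (cycle_fun s par) x < fun_form a b (star_fun s' c0) x.
  by split=> //; [apply: ltW | apply: Or31].
rewrite /star_fun !cycle_form // [in ltRHS](bigD1 c0) //=.
have -> : star_par s' c0 c0 = r by rewrite /star_par eqxx.
have -> : \sum_(v | (v \notin s') && (v != c0)) phi v (star_par s' c0 v)
    = \sum_(v | (v \notin s) && (v != u)) phi v u.
  apply: eq_big => v; last by case/andP=> _ /negPf v0; rewrite /star_par v0.
  by rewrite !inE !negb_or; case: (v == u); case: (v == c0); rewrite //= !andbF.
have walk_lt : walk_form r (rcons t c0) < walk_form r (rcons t u).
  rewrite -!cats1 !walk_form_cat ltrD2l /= ltrD2r edge_form_lt //.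
  by rewrite umax // mem_head.
move: le_r walk_lt; rewrite -/s; lra.
Qed.

Lemma improve_unicyclic (s : seq V) par (d : V -> nat) :
  uniq s -> (3 <= size s)%N -> (forall v, v \notin s -> (d (par v) < d v)%N) ->
  (forall u, u \in s -> exists2 w, w \notin s & par w != u) ->
  improved (cycle_fun s par) (size s).
Proof.
move=> us s3 dec not_star.
have [v0 v0s] : exists v0, v0 \in s.
  by case: (s) s3 => [//|v0 t] _; exists v0; rewrite mem_head.
have rot_improved n : improved (cycle_fun (rot n s) par) (size (rot n s)) ->
    improved (cycle_fun s par) (size s).
  rewrite size_rot; apply: improved_same.
  - exact: cycle_fun_no_short dec.
  - apply: (@cycle_fun_no_short _ _ _ d); rewrite ?rot_uniq ?size_rot // => v.
    by rewrite mem_rot; apply: dec.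
  - by apply: same_graph_ext => v; rewrite cycle_fun_rot.
have [u u_s umaxs] := arg_maxP x v0s.
have [w _ wmax] := arg_maxP x (isT : xpredT v0).
have {}wmax v : x v <= x w by apply: wmax.
(* A tie between the maximum on the cycle and the overall maximum counts as a hub on the cycle; a
   hub off the cycle thus exceeds all cycle vertices strictly. *)
case: (lerP (x w) (x u)) => [wu|uw]; last first.
  have ws : w \notin s by apply: contraTN uw => /umaxs; rewrite -leNgt.
  have [r rs le_r] := reroute_to_max dec wmax ws.
  have [n t st] := rot_to (etrans (mem_prev s r) rs).
  apply: (rot_improved n); have ust : uniq (prev s r :: t) by rewrite -st rot_uniq.
  have st3 : (3 <= size (prev s r :: t))%N by rewrite -st size_rot.
  have : next (prev s r :: t) (prev s r) = r by rewrite -st next_rot ?next_prev.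
  rewrite st; have mem_st v : (v \in prev s r :: t) = (v \in s) by rewrite -st mem_rot.
  case: t {st} ust st3 mem_st => [//|r' t] ust st3 mem_st.
  rewrite /next /= eqxx => rE; rewrite {r'}rE in ust st3 mem_st *.
  apply: (@improve_tree_hub _ _ _ _ w) => // [v|].
    by rewrite mem_st => /umaxs /le_lt_trans; apply.
  rewrite (eq_bigl _ _ (fun v => congr1 negb (mem_st v))).
  by rewrite [X in _ <= X + _](eq_bigl _ _ (fun v => congr1 (andb^~ _) (congr1 negb (mem_st v)))).
have umax v : x v <= x u by apply: le_trans wu.
have [n t st] := rot_to u_s; apply: (rot_improved n); rewrite st.
have ust : uniq (u :: t) by rewrite -st rot_uniq.
have st3 : (3 <= size (u :: t))%N by rewrite -st size_rot.
have mem_st v : (v \in u :: t) = (v \in s) by rewrite -st mem_rot.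
have dect v : v \notin u :: t -> (d (par v) < d v)%N by rewrite mem_st; apply: dec.
have child : exists2 w, w \notin u :: t & par w != u.
  by have [w' ws pw] := not_star u u_s; exists w'; rewrite ?mem_st.
case: t {st mem_st} ust st3 dect child => [//|c1 t] ust st3 dect child.
case: (lerP (x (last c1 t)) (x c1)) => [last_le|last_gt].
  exact: improve_cycle_hub dect umax last_le child.
(* Reversing the cycle behind [u] puts the larger of its two cycle neighbours second. *)
pose t' := rev (c1 :: t).
have rev_rot : rot (size (c1 :: t)) (rev (u :: c1 :: t)) = u :: t'.
  by rewrite (rev_cons u) -(size_rev (c1 :: t)) -cats1 rot_size_cat.
have ust' : uniq (u :: t') by rewrite -rev_rot rot_uniq rev_uniq.
have mem_t' v : (v \in u :: t') = (v \in u :: c1 :: t).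
  by rewrite -rev_rot mem_rot mem_rev.
have size_t' : size (u :: t') = size (u :: c1 :: t).
  by rewrite -rev_rot size_rot size_rev.
apply: (@improved_same _ (cycle_fun (u :: t') par)).
- exact: cycle_fun_no_short dect.
- apply: (@cycle_fun_no_short _ _ _ d); rewrite ?size_t' // => v.
  by rewrite mem_t'; apply: dect.
- rewrite /same_graph (same_graph_rev par ust).
  by apply: same_graph_ext => v; rewrite -rev_rot cycle_fun_rot ?rev_uniq.
rewrite -size_t'; have t'E : t' = last c1 t :: rev (belast c1 t).
  by rewrite /t' lastI rev_rcons.
have last_t' : last (last c1 t) (rev (belast c1 t)) = c1.
  case: (t) => [//|c2 t2] /=; by rewrite rev_cons last_rcons.
rewrite t'E in ust' mem_t' size_t' *.
apply: (improve_cycle_hub (d := d)) => //; rewrite ?size_t' //.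
- by move=> v; rewrite mem_t'; apply: dect.
- by rewrite last_t' ltW.
by case: child => w' ws pw; exists w'; rewrite ?mem_t'.
Qed.

End Forms.

(** * The hypergraphs UC_l *)

Lemma next_nth_mod (V : eqType) (v0 : V) (s : seq V) i : uniq s -> (i < size s)%N ->
  next s (nth v0 s i) = nth v0 s (i.+1 %% size s).
Proof.
move=> us i_s; rewrite -(nth_map _ v0) // map_next //.
case: s us i_s => [//|a t] us; rewrite rot1_cons nth_rcons /= ltnS leq_eqVlt.
case/orP=> [/eqP->|i_t]; first by rewrite ltnn eqxx modnn.
by rewrite i_t modn_small.
Qed.

Lemma bij_inj_surj (A B : finType) (f : A -> B) : injective f ->
  (forall y, exists x, f x = y) -> bijective f.
Proof.
move=> finj fsurj; have fsurjb y : exists x, f x == y.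
  by have [x <-] := fsurj y; exists x.
have fK y : f (xchoose (fsurjb y)) = y by apply/eqP/(xchooseP (fsurjb y)).
by exists (fun y => xchoose (fsurjb y)) => // x; apply: finj; rewrite fK.
Qed.

Section PowerFunGraph.
Variables (m : nat) (G : hypergraph) (f : G -> G).
Hypothesis fns : no_short_cycle f.
Hypothesis GE : edges G = [set [set v; f v] | v : G].

Definition fun_edge (v : G) : {e : {set G} | e \in edges G} :=
  exist _ [set v; f v] (fun_edge_in GE v).

(** Since each vertex owns one edge, pairs coordinatise the power: [None] stands for the vertex
    itself, [Some j] for the j-th inner vertex of its edge. *)
Definition power_fun_vertex (p : G * option 'I_(m - 2)) : power_hypergraph m G :=
  if p.2 is Some j then inr (fun_edge p.1, j) else inl p.1.

Lemma fun_edge_surj e : exists v, fun_edge v = e.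
Proof.
case: e => e eG; have /imsetP[v _ eE] : e \in [set [set v; f v] | v : G].
  by rewrite -GE.
by exists v; apply: val_inj.
Qed.

Lemma power_fun_vertex_bij : bijective power_fun_vertex.
Proof.
apply: bij_inj_surj => [[v [i|]] [w [j|]] //=|].
- by move=> [/(fun_edge_inj fns) -> ->].
- by move=> [->].
move=> [v|[e j]]; first by exists (v, None).
by have [v <-] := fun_edge_surj e; exists (v, Some j).
Qed.

Lemma power_fun_edgeE v : power_edge m (fun_edge v)
  = [set power_fun_vertex (v, None); power_fun_vertex (f v, None)]
    :|: [set power_fun_vertex (v, Some j) | j : 'I_(m - 2)].
Proof. by rewrite /power_edge imsetU1 imset_set1. Qed.

Lemma power_fun_edges :
  edges (power_hypergraph m G) = [set power_edge m (fun_edge v) | v : G].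
Proof.
apply/setP => e; apply/imsetP/imsetP => -[e' _ ->]; last by exists (fun_edge e').
by have [v <-] := fun_edge_surj e'; exists v.
Qed.

End PowerFunGraph.

Section UnicyclicIso.
Variables (m l : nat) (c : seq nat) (V : finType) (s : seq V) (par : V -> V) (v0 : V).
Hypotheses (hm : (2 <= m)%N) (us : uniq s) (sl : size s = l).
Hypothesis par_s : forall v, v \notin s -> par v \in s.
Hypothesis cE : forall i, (i < l)%N ->
  #|[set v | (v \notin s) && (par v == nth v0 s i)]| = nth 0%N c i.

Local Notation f := (cycle_fun s par).
Local Notation G := (fun_graph f).
Local Notation cc := (fun x : CL m l => if x is inl i then nth 0%N c i else 0%N).
Local Notation pend := (pendant cc).

Let core (i : 'I_l) : V := nth v0 s i.
Let children (x : CL m l) : {set V} :=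
  if x is inl i then [set v | (v \notin s) && (par v == core i)] else set0.
Let leaf (p : pend) : V := nth v0 (enum (children (tag p))) (tagged p).
Let base (b : 'I_l + pend) : V :=
  match b with inl i => core i | inr p => leaf p end.

Lemma unicyclic_core_in i : core i \in s.
Proof. by rewrite mem_nth ?sl. Qed.

Lemma unicyclic_leaf_in p : leaf p \in children (tag p).
Proof.
rewrite -mem_enum mem_nth // -cardE.
case: p => -[i|y] [a /= a_lt] //.
by rewrite [X in (_ < X)%N](cE (ltn_ord i)).
Qed.

Lemma unicyclic_leafP p : exists i, [/\ tag p = inl i, leaf p \notin s
  & par (leaf p) = core i].
Proof.
have := unicyclic_leaf_in p; rewrite /children; case tp: (tag p) => [i|y].
  by rewrite inE => /andP[? /eqP ?]; exists i.
by rewrite inE.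
Qed.

Lemma unicyclic_base_bij : bijective base.
Proof.
apply: bij_inj_surj => [[i|p] [j|q] /=|v].
- move/eqP; rewrite nth_uniq ?sl //.
  by move/eqP/val_inj->.
- move=> eq_ip; have [? [_ /negP[]]] := unicyclic_leafP q.
  by rewrite -eq_ip unicyclic_core_in.
- move=> eq_ip; have [? [_ /negP[]]] := unicyclic_leafP p.
  by rewrite eq_ip unicyclic_core_in.
- case: p q => [[i|y] [a a_lt]] [[j|y'] [b b_lt]] // eq_ab.
  set p := existT _ _ _ in eq_ab *; set q := existT _ _ _ in eq_ab *.
  have [i' [[ii'] _ pi]] := unicyclic_leafP p.
  have [j' [[jj'] _ pj]] := unicyclic_leafP q.
  have ij : i = j.
    apply/val_inj/eqP.
    have i_s : (i < size s)%N by rewrite sl.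
    have j_s : (j < size s)%N by rewrite sl.
    by rewrite -(nth_uniq v0 i_s j_s us) -/(core i) ii' -pi eq_ab pj jj'.
  move: eq_ab; rewrite {}/p {}/q in pi pj *; move=> eq_ab.
  clear i' j' ii' jj' pi pj; subst j.
  have ab : a = b.
    have a_ch : (a < size (enum (children (inl i))))%N by rewrite -cardE /= (cE (ltn_ord i)).
    have b_ch : (b < size (enum (children (inl i))))%N by rewrite -cardE /= (cE (ltn_ord i)).
    by move/eqP: eq_ab; rewrite /base /leaf /= nth_uniq ?enum_uniq // => /eqP.
  by subst b; congr (inr (existT _ _ _)); apply: val_inj.
case: (boolP (v \in s)) => vs.
  have v_lt : (index v s < l)%N by rewrite -sl index_mem.
  by exists (inl (Ordinal v_lt)); rewrite /= /core nth_index.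
have i_lt : (index (par v) s < l)%N by rewrite -sl index_mem par_s.
pose i := Ordinal i_lt.
have v_ch : v \in children (inl i) by rewrite inE vs /core nth_index ?par_s /=.
have a_lt : (index v (enum (children (inl i))) < nth 0%N c i)%N.
  by rewrite -(cE i_lt) cardE index_mem mem_enum.
exists (inr (existT _ (inl i) (Ordinal a_lt))).
by rewrite /= /leaf /= nth_index ?mem_enum.
Qed.

Let m1E : (m - 1)%N = (m - 2).+1.
Proof. by case: m hm => [|[|n]] // _; rewrite !subSS !subn0. Qed.

(** Of the m-1 new vertices of a pendant edge, number 0 plays the leaf of the graph, and the other
    m-2 are inner vertices of the power. *)
Let split_vertex (y : UC m l c) : ('I_l + pend) * option 'I_(m - 2) :=
  match y with
  | inl (inl i) => (inl i, None)
  | inl (inr (i, j)) => (inl i, Some j)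
  | inr (p, j) => (inr p, unlift ord0 (cast_ord m1E j))
  end.

Lemma unicyclic_split_bij : bijective split_vertex.
Proof.
pose join (q : ('I_l + pend) * option 'I_(m - 2)) : UC m l c :=
  match q with
  | (inl i, None) => inl (inl i)
  | (inl i, Some j) => inl (inr (i, j))
  | (inr p, None) => inr (p, cast_ord (esym m1E) ord0)
  | (inr p, Some j) => inr (p, cast_ord (esym m1E) (lift ord0 j))
  end.
exists join => [[[i|[i j]]|[p j]]|[[i|p] [j|]]] //=.
- case: unliftP => [j'|] jE; congr (inr (_, _)); rewrite -jE.
    by rewrite cast_ordK.
  by rewrite cast_ordK.
- by rewrite cast_ordKV liftK.
- by rewrite cast_ordKV unlift_none.
Qed.

Hypothesis f_no_short : no_short_cycle f.

Lemma UC_iso : hiso (UC m l c) (power_hypergraph m G).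
Proof.
pose GE : edges G = _ := erefl.
pose K : G * option 'I_(m - 2) -> power_hypergraph m G := power_fun_vertex GE.
pose F (y : UC m l c) := K (base (split_vertex y).1, (split_vertex y).2).
have Fbij : bijective F.
  have [g gK Kg] := unicyclic_base_bij.
  have [h hK Kh] := unicyclic_split_bij.
  have [k kK Kk] : bijective K by apply: power_fun_vertex_bij.
  exists (fun y => h (g (k y).1, (k y).2)) => y; rewrite /F.
    by rewrite kK /= gK -surjective_pairing hK.
  by rewrite Kh /= Kg -surjective_pairing Kk.
have E_core i : F @: old_edge m cc (CL_edge m i) = power_edge m (fun_edge GE (core i)).
  rewrite power_fun_edgeE /old_edge -imset_comp imsetU imsetU1 imset_set1 -imset_comp.
  congr ([set _; _] :|: _); rewrite /F /K /power_fun_vertex /=; congr inl.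
  by rewrite /cycle_fun unicyclic_core_in /core next_nth_mod ?sl.
have E_leaf p : F @: pendant_edge m p = power_edge m (fun_edge GE (leaf p)).
  have [i [tp leaf_s par_leaf]] := unicyclic_leafP p.
  rewrite power_fun_edgeE /pendant_edge imsetU1 -imset_comp tp.
  have -> : F (inl (inl i)) = K (f (leaf p), None).
    by rewrite /F /= /cycle_fun (negPf leaf_s) par_leaf.
  rewrite -setUA setUCA; congr (_ |: _); apply/setP => y; rewrite !inE.
  apply/imsetP/orP => [[j _ ->]|[/eqP->|/imsetP[j _ ->]]].
  - rewrite /F /=; case: unliftP => [j'|] _; last by left.
    by right; apply/imsetP; exists j'.
  - by exists (cast_ord (esym m1E) ord0) => //; rewrite /F /= cast_ordKV unlift_none.
  - exists (cast_ord (esym m1E) (lift ord0 j)) => //.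
    by rewrite /F /= cast_ordKV liftK.
exists F => //; rewrite (power_fun_edges m GE); apply/setP => e.
apply/imsetP/imsetP => [[e' + ->]|[v _ ->]].
  case/setUP => /imsetP[e'' + ->]; last by exists (leaf e'').
  by case/imsetP=> i _ ->; exists (core i).
have [g _ Kg] := unicyclic_base_bij; rewrite -(Kg v); case: (g v) => [i|p] /=.
  exists (old_edge m cc (CL_edge m i)) => //.
  by rewrite inE; apply/orP; left; apply/imset_f/imset_f.
exists (pendant_edge m p) => //.
by rewrite inE; apply/orP; right; apply: imset_f.
Qed.

End UnicyclicIso.

(** * Structure of unicyclic power hypergraphs *)

Lemma loose_cycle_iso (H H' : hypergraph) (f : H -> H') l C : injective f ->
  [set f @: e | e : {set H} in edges H] = edges H' ->
  loose_cycle_of l C -> loose_cycle_of l [set f @: e | e : {set H} in C].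
Proof.
move=> finj fE [v [e [[l3 vinj einj eH [ecap edisj]] ->]]].
exists (f \o v), (fun i => f @: e i); split; last first.
  by rewrite -imset_comp.
split=> //; first exact: inj_comp.
- by move=> i j /(imset_inj finj)/einj.
- by move=> i; rewrite -fE imset_f.
split=> [i|i j ij ipj jpi].
  by rewrite -imsetI ?ecap ?imset_set1 // => ? ? _ _; apply: finj.
by rewrite imset_disjoint ?edisj.
Qed.

Lemma loose_cycle_unique_iso (H H' : hypergraph) : hiso H H' -> unicyclic H ->
  forall l l' C C', @loose_cycle_of H' l C -> loose_cycle_of l' C' -> C = C'.
Proof.
move=> /hiso_sym[f /bij_inj finj fE] [_ [C0 [_ C0_uniq]]] l l' C C' lC lC'.
apply: (imset_inj (imset_inj finj)).
rewrite -(C0_uniq [set f @: e | e : {set H'} in C]); last first.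
  by exists l; apply: loose_cycle_iso lC.
by apply: C0_uniq; exists l'; apply: loose_cycle_iso lC'.
Qed.

Lemma hconnected_iso (H H' : hypergraph) : hiso H H' -> hconnected H -> hconnected H'.
Proof.
move=> [f [g fK gK] fE] Hconn x y; have finj := can_inj fK.
have /connectP[p] := Hconn (g x) (g y); elim: p x => [|z p IH] x /=.
  by move=> _ /(can_inj gK)->; apply: connect0.
case/andP=> xz zp yE; apply: (connect_trans (y := f z)); last first.
  by apply: IH; rewrite fK.
apply: connect1; move: xz; rewrite /hadj -(inj_eq finj) gK => /andP[-> /=].
case/exists_inP=> e eH /andP[xe ze]; apply/exists_inP; exists (f @: e).
  by rewrite -fE imset_f.
by rewrite mem_imset // ze andbT -[x]gK mem_imset.
Qed.

Lemma ordS_neq l (i : 'I_l) : (2 <= l)%N -> ordS i != i.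
Proof.
move=> l2; apply/eqP => /(congr1 val) /=; have := ltn_ord i.
rewrite leq_eqVlt => /orP[/eqP il|il]; last by rewrite modn_small //; lia.
by rewrite il modnn; lia.
Qed.

Lemma ordSS_neq l (i : 'I_l) : (3 <= l)%N -> ordS (ordS i) != i.
Proof.
move=> l3; apply/eqP => /(congr1 val) /=; have := ltn_ord i.
rewrite leq_eqVlt => /orP[/eqP il|il]; first by rewrite il modnn modn_small; lia.
rewrite (modn_small il); move: il; rewrite leq_eqVlt => /orP[/eqP il|il].
  by rewrite il modnn; lia.
by rewrite modn_small //; lia.
Qed.

(** * Loose cycles of a power and cycles of its graph *)

Section PowerCycles.
Variables (m l : nat) (G : hypergraph).
Hypothesis G2 : huniform 2 G.
Local Notation P := (power_hypergraph m G).

Lemma power_edge_inj : injective (@power_edge m G).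
Proof.
move=> e e' ee'; apply/val_inj/setP => x.
by rewrite -!(mem_power_edge_inl m) ee'.
Qed.

(** Inner vertices lie in one edge each, so consecutive edges meet only on the graph; a second
    common vertex there would make the cycle return after two steps, which three distinct vertices
    exclude. *)
Lemma power_loose_cycle (c : 'I_l -> G) : (3 <= l)%N -> injective c ->
  (forall i, [set c i; c (ordS i)] \in edges G) ->
  exists2 C, @loose_cycle_of P l C &
    forall i e, val e = [set c i; c (ordS i)] -> power_edge m e \in C.
Proof.
move=> l3 cinj cE; pose E i : {e : {set G} | e \in edges G} :=
  exist (fun e => e \in edges G) _ (cE i).
exists [set power_edge m (E i) | i : 'I_l]; last first.
  by move=> i e eE; apply/imsetP; exists i => //; congr power_edge; apply: val_inj.
have l2 : (2 <= l)%N by apply: ltnW.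
have Einj : injective E.
  move=> i j /(congr1 val) /= /setP ij; have := ij (c i); have := ij (c (ordS i)).
  rewrite !inE !eqxx orbT !(inj_eq cinj) /= => /esym Si /esym/orP[/eqP//|/eqP iE].
  move: Si; rewrite {i ij}iE => /orP[].
    by rewrite (negPf (ordSS_neq _ l3)).
  by rewrite (inj_eq (@ordS_inj _)) (negPf (ordS_neq _ l2)).
exists (inl \o c), (fun i => power_edge m (E i)); split=> //; split=> //.
- by move=> i j [/cinj].
- by move=> i j /power_edge_inj/Einj.
- by move=> i; apply: imset_f.
split=> [i|i j ij ipj jpi].
  apply/setP => -[x|[e j]]; rewrite in_setI ?mem_power_edge_inl ?mem_power_edge_inr.
    rewrite !inE ord_predK (inj_eq (@inl_inj _ _)).
    case: (eqVneq x (c i)) => [_|xi] /=; first by rewrite orbT.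
    rewrite orbF; apply/negP => /andP[/eqP-> /eqP/cinj/eqP].
    rewrite -(inj_eq (@ordS_inj _)) ord_predK eq_sym.
    by rewrite (negPf (ordSS_neq _ l3)).
  rewrite inE; apply/negbTE/negP => /andP[/eqP-> /eqP/Einj/eqP].
  by rewrite -(inj_eq (@ordS_inj _)) ord_predK eq_sym (negPf (ordS_neq _ l2)).
rewrite disjoint_subset; apply/subsetP => -[x|[e k]] yi; apply/negP => /=;
  move: yi; rewrite !(mem_power_edge_inl, mem_power_edge_inr).
  have iSj : i != ordS j by apply: contra jpi => /eqP->; rewrite ordSK.
  have jSi : j != ordS i by apply: contra ipj => /eqP->; rewrite ordSK.
  rewrite !inE => /orP[]/eqP->; rewrite !(inj_eq cinj).
    by rewrite (negPf ij) (negPf iSj).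
  by rewrite eq_sym (negPf jSi) (inj_eq (@ordS_inj _)) (negPf ij).
by move=> /eqP->; rewrite (inj_eq Einj); apply/negP.
Qed.

(** A core vertex lies in two different edges, hence is not an inner vertex. *)
Lemma power_loose_cycle_inv C : @loose_cycle_of P l C ->
  (3 <= l)%N /\ exists c : 'I_l -> G, [/\ injective c,
    forall i, [set c i; c (ordS i)] \in edges G
  & forall e, power_edge m e \in C -> exists i, val e = [set c i; c (ordS i)]].
Proof.
move=> [v [e [[l3 vinj einj eP [ecap _]] CE]]]; split=> //.
have l2 : (2 <= l)%N by apply: ltnW.
have /fin_all_exists[E EE] i : exists E, e i = power_edge m E.
  by have /imsetP[E _ ->] := eP i; exists E.
have v_cap i : v i \in e (ord_pred i) :&: e i by rewrite ecap set11.
have /fin_all_exists[c cE] i : exists x, v i = inl x.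
  case vi: (v i) => [x|[e' j]]; first by exists x.
  have := v_cap i; rewrite vi inE !EE !mem_power_edge_inr.
  case/andP=> /eqP e1 /eqP e2; have ip : ord_pred i = i.
    by apply: einj; rewrite !EE -e1 -e2.
  by have := ordS_neq (ord_pred i) l2; rewrite ord_predK ip eqxx.
have cinj : injective c by move=> i j ij; apply: vinj; rewrite !cE ij.
have valE i : val (E i) = [set c i; c (ordS i)].
  have := v_cap i; have := v_cap (ordS i).
  rewrite ordSK !inE !cE !EE !mem_power_edge_inl => /andP[ci _] /andP[_ cSi].
  have [w cw Ew] := graph_edgeE G2 (valP (E i)) cSi.
  move: ci; rewrite Ew !inE => /orP[/eqP/cinj|/eqP->] //.
  by move/eqP; rewrite (negPf (ordS_neq _ l2)).
exists c; split=> // [i|e']; first by rewrite -valE (valP (E i)).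
rewrite CE => /imsetP[i _]; rewrite EE => /power_edge_inj ->.
by exists i.
Qed.

(** Each inner vertex on a path is replaced by an end of its edge; consecutive representatives still
    share an edge or coincide. *)
Lemma power_hconnected : hconnected P -> hconnected G.
Proof.
move=> Pconn u v.
pose rep (y : P) : G := match y with
  | inl x => x | inr (e, _) => odflt u [pick x in val e] end.
have rep_in e y : y \in power_edge m e -> rep y \in val e.
  case: y => [x|[e' j]]; first by rewrite mem_power_edge_inl.
  rewrite mem_power_edge_inr => /eqP-> /=; case: pickP => //= e0.
  have := edges_nonempty G; rewrite (_ : set0 = val e) ?(valP e) //.
  by apply/setP => x; rewrite inE e0.
suff step (x y : P) : connect (@hadj P) x y -> connect (@hadj G) (rep x) (rep y).
  exact: (step (inl u) (inl v)).
case/connectP=> p; elim: p x => [|z p IH] x /=; first by move=> _ ->.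
case/andP=> /andP[_ /exists_inP[e /imsetP[E _ ->] /andP[/rep_in xE /rep_in zE]]] zp yE.
apply: connect_trans (IH _ zp yE).
case: (eqVneq (rep x) (rep z)) => [->|ne]; first exact: connect0.
apply: connect1; rewrite /hadj ne; apply/exists_inP.
by exists (val E); rewrite ?(valP E) ?xE.
Qed.

End PowerCycles.

(* A shortest path to [s] gives the parent, its length the rank. *)
Lemma connected_parent (G : hypergraph) (s : seq G) v0 : hconnected G -> v0 \in s ->
  exists (par : G -> G) (d : G -> nat), forall v, v \notin s ->
    hadj v (par v) /\ (d (par v) < d v)%N.
Proof.
move=> Gconn v0s.
pose reach v n := [exists p : n.-tuple G, path (@hadj G) v p && (last v p \in s)].
have ex_reach v : exists n, reach v n.
  have /connectP[p vp lastp] := Gconn v v0.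
  by exists (size p); apply/existsP; exists (in_tuple p); rewrite vp -lastp.
pose d v := ex_minn (ex_reach v).
have /fin_all_exists[par parP] v :
    exists u, v \notin s -> hadj v u /\ (d u < d v)%N.
  case: (boolP (v \in s)) => vs; first by exists v.
  rewrite {2}/d; case: ex_minnP => n /existsP[p /andP[vp lastp]] _.
  case: p vp lastp => -[|u p] /= sp; first by rewrite (negPf vs).
  case/andP=> vu up lastp; exists u => _; split=> //.
  rewrite -(eqP sp) ltnS /d; case: ex_minnP => k _; apply.
  by apply/existsP; exists (in_tuple p); rewrite up.
by exists par, d.
Qed.

(** The nonemptiness proof is a Boolean equality, hence unique, so equal edge sets give equal
    records. *)
Lemma fun_graphE (G : hypergraph) (f : G -> G) :
  edges G = [set [set v; f v] | v : G] -> G = fun_graph f.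
Proof.
case: G f => V E E0 f /= EE; rewrite /fun_graph; move: (fun_graph_nonempty f).
by rewrite -EE => E0'; congr Hypergraph; apply: bool_irrelevance.
Qed.

(** The cycle together with the parent edges is a connected spanning subgraph [F]. A further edge ab
    would close a simple path of [F] to a cycle through ab, whose lift contradicts the uniqueness of
    the loose cycle. *)
Lemma unicyclic_graph_fun (m l : nat) (G : hypergraph) C : huniform 2 G ->
  hconnected G -> @loose_cycle_of (power_hypergraph m G) l C ->
  (forall l' C', @loose_cycle_of (power_hypergraph m G) l' C' -> C = C') ->
  exists (s : seq G) (par : G -> G) (d : G -> nat),
    [/\ uniq s, size s = l, (3 <= l)%N, forall v, v \notin s -> (d (par v) < d v)%N
      & edges G = [set [set v; cycle_fun s par v] | v : G]].
Proof.
move=> G2 Gconn lC Cuniq.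
have [l3 [c [cinj cE CP]]] := power_loose_cycle_inv G2 lC.
have i0 : 'I_l by case: l l3 {lC c cinj cE CP} => // n _; exact: ord0.
pose s := [seq c i | i : 'I_l]; pose v0 := c i0.
have us : uniq s by rewrite map_inj_uniq ?enum_uniq.
have sl : size s = l by rewrite size_map size_enum_ord.
have cs i : c i \in s by apply/mapP; exists i; rewrite ?mem_enum.
have s_nth (i : 'I_l) : nth v0 s i = c i.
  by rewrite (nth_map i) ?size_enum_ord // nth_ord_enum.
have next_c i : next s (c i) = c (ordS i).
  by rewrite -!s_nth next_nth_mod ?sl.
have [par [d parP]] := connected_parent Gconn (cs i0).
have dec v : v \notin s -> (d (par v) < d v)%N by case/parP.
exists s, par, d; split=> //; set f := cycle_fun s par.
have fns : no_short_cycle f by apply: (cycle_fun_no_short us _ dec); rewrite sl.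
have f_edge v : [set v; f v] \in edges G.
  rewrite /f /cycle_fun; case: ifPn => [/mapP[i _ ->]|/parP[+ _]].
    by rewrite next_c.
  by rewrite hadj_graph.
pose F := fun_graph f.
have F_hadj (u v : G) : @hadj F u v -> @hadj G u v.
  rewrite (hadj_fun (G := F) fns erefl) => /orP[]/eqP <-; rewrite hadj_graph //.
  by rewrite setUC.
have to_v0 v : connect (@hadj F) v v0.
  have [n] := ubnP (d v); elim: n v => // n IH v; rewrite ltnS => dv.
  case: (boolP (v \in s)) => vs; last first.
    apply: (connect_trans (y := par v)); last by apply/IH/(leq_trans (dec v vs)).
    apply: connect1; rewrite (hadj_fun (G := F) fns erefl) /f /cycle_fun (negPf vs).
    by rewrite eqxx orbT.
  have connect_sym : connect_sym (@hadj F).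
    by apply: sym_connect_sym => x y; apply: hadj_sym.
  have reach i : (i < size s)%N -> connect (@hadj F) (nth v0 s 0) (nth v0 s i).
    elim: i => [|i IHi] i_s; first exact: connect0.
    apply: connect_trans (IHi (ltnW i_s)) _; apply: connect1.
    rewrite (hadj_fun (G := F) fns erefl); apply/orP; right.
    rewrite /f /cycle_fun mem_nth ?(ltnW i_s) //.
    by rewrite next_nth_mod ?(ltnW i_s) // modn_small // eqxx.
  apply: (connect_trans (y := nth v0 s 0)).
    by rewrite connect_sym -[v in X in connect _ _ X](nth_index v0 vs) reach ?index_mem.
  have v0_lt : (index v0 s < size s)%N by rewrite index_mem cs.
  by have := reach _ v0_lt; rewrite nth_index ?cs.
apply/setP => e; apply/idP/imsetP => [eG|[v _ ->]]; last exact: f_edge.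
have /eqP/cards2P[a [b [ab eE]]] := G2 _ eG.
case: (boolP [exists v, e == [set v; f v]]) => [/existsP[v /eqP->]|]; first by exists v.
move/existsPn => e_notF; exfalso.
have ab_notF : ~~ @hadj F a b.
  rewrite (hadj_fun (G := F) fns erefl) negb_or; apply/andP; split.
    by apply: contra (e_notF b) => /eqP->; rewrite eE setUC.
  by apply: contra (e_notF a) => /eqP->; rewrite eE.
have connect_sym : connect_sym (@hadj F).
  by apply: sym_connect_sym => x y; apply: hadj_sym.
have /connectP[p0 ap0 bE0] : connect (@hadj F) a b.
  by apply: connect_trans (to_v0 a) _; rewrite connect_sym.
case/shortenP: ap0 bE0 => p ap up _ bE {p0}.
(* The path has an interior vertex because ab is not an edge of [F]. *)
have q3 : (3 <= size (a :: p))%N.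
  case: p ap {up} bE => [|b' [|b'' p]] //=; first by move=> _ abE; rewrite abE eqxx in ab.
  by rewrite andbT => abE bE; rewrite bE abE in ab_notF.
have q_cycle : cycle (@hadj G) (a :: p).
  rewrite /= rcons_path -bE; apply/andP; split.
    by apply: sub_path ap => x y; apply: F_hadj.
  by rewrite hadj_sym hadj_graph // -eE.
pose q := a :: p; pose c' (i : 'I_(size q)) := nth a q i.
have c'inj : injective c'.
  by move=> i j /eqP; rewrite nth_uniq // => /eqP/val_inj.
have c'next i : c' (ordS i) = next q (c' i) by rewrite next_nth_mod.
have c'E i : [set c' i; c' (ordS i)] \in edges G.
  by rewrite c'next -hadj_graph // next_cycle // mem_nth.
have [C' lC' C'P] := power_loose_cycle m q3 c'inj c'E.
(* By uniqueness ab is an edge of the original cycle, hence of [F] after all. *)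
have C'C := Cuniq _ _ lC'; rewrite -{}C'C in C'P.
have b_lt : (index b q < size q)%N by rewrite index_mem bE mem_last.
have := C'P (Ordinal b_lt) (exist (fun e => e \in edges G) e eG).
rewrite c'next /c' nth_index; last first.
  by rewrite bE mem_last.
have nb : next q b = a by rewrite bE next_last.
rewrite nb setUC -eE => /(_ erefl)/CP[i /= eci].
by have := e_notF (c i); rewrite eci /f /cycle_fun cs next_c eqxx.
Qed.

Lemma unicyclic_power_fun (m l : nat) (H : hypergraph) :
  is_power_hypergraph m H -> hconnected H -> unicyclic H ->
  (exists C : {set {set H}}, loose_cycle_of l C) ->
  exists (V : finType) (s : seq V) (par : V -> V) (d : V -> nat),
    [/\ uniq s, size s = l, (3 <= l)%N, forall v, v \notin s -> (d (par v) < d v)%N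
      & hiso H (power_hypergraph m (fun_graph (cycle_fun s par)))].
Proof.
move=> [G [G2 HG]] Hconn Huni [C lC].
have [f /bij_inj finj fE] := HG.
have [||s [par [d [us sl l3 dec GE]]]] :=
    unicyclic_graph_fun G2 _ (loose_cycle_iso finj fE lC).
- exact/power_hconnected/(hconnected_iso HG).
- by move=> l' C' lC'; apply: (loose_cycle_unique_iso HG Huni) lC'; apply: loose_cycle_iso lC.
by exists G, s, par, d; split=> //; rewrite -(fun_graphE GE).
Qed.

(** * The upper bound *)

(** With n = m-1, these are the strict row inequalities at the hub (value 1, degree N), at its
    neighbour carrying [w], and at a leaf; the value is t on the rest of the cycle and at [w], and
    t' at the leaves of the hub. *)
Lemma star_weights (R : realFieldType) (n N c : R) : 1 <= n -> 8 <= N -> 0 < c ->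
  c ^+ 2 = (n + 1) * c + n * N ->
  exists t t' : R, [/\ 0 < t, 0 < t',
    (c + 1) * (2 * t + (N - 2) * t') < N + 3 * c,
    c + 1 < t * (n * N + c - 3 * n + 1)
    & c + 1 < t' * (n * N + 3 * c - n + 1)].
Proof.
move=> n1 N8 c_gt0 cE; set D := n * N + c - 3 * n + 1.
have nN : 8 * n <= n * N by rewrite mulrC ler_pM2l //; lra.
have D_gt0 : 0 < D by rewrite /D; lra.
have Dn_gt0 : 0 < D + n by lra.
(* [t0] turns the second inequality into an equality. The third would allow the denominator D + 2c +
   2n, so D + n keeps it strict and puts t' below t0. *)
pose t0 := (c + 1) / D; pose t' := (c + 1) / (D + n).
have t'_gt0 : 0 < t' by rewrite divr_gt0 //; lra.
have t'_lt : t' < t0 by rewrite /t' /t0 ltr_pM2l ?ltf_pV2 ?posrE //; lra.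
(* The first inequality in weak form, with all N neighbours at [t0]. By the equation for [c] the
   difference reduces to c (n-1) (2N-6), which vanishes for m = 2; the strictness has to come from
   t' < t0. *)
have hub : N * (c + 1) * t0 <= N + 3 * c.
  rewrite /t0 mulrA ler_pdivrMr // -subr_ge0.
  have -> : (N + 3 * c) * D - N * (c + 1) * (c + 1)
      = c * ((n - 1) * (2 * N - 6))
        + (3 - N) * (c ^+ 2 - ((n + 1) * c + n * N)) by rewrite /D; ring.
  by rewrite cE subrr mulr0 addr0 !mulr_ge0 //; lra.
have t0D : t0 * D = c + 1 by rewrite /t0 divfK ?gt_eqF.
have t'D : t' * (D + n) = c + 1 by rewrite /t' divfK ?gt_eqF.
(* t exceeds t0 by as much as t' falls short of it. The hub has two neighbours of value t against
   N-2 of value t', so it still gains N-4 times this gap. *)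
exists (2 * t0 - t'), t'; split=> //; first by lra.
- apply: lt_le_trans hub.
  rewrite -subr_gt0 (_ : _ - _ = (c + 1) * ((N - 4) * (t0 - t'))); last by ring.
  by rewrite !mulr_gt0 //; lra.
- rewrite -/D -t0D ltr_pM2r //; lra.
rewrite -t'D ltr_pM2l // /D; lra.
Qed.

Section Star.
Variables (V : finType) (u c1 : V) (t : seq V) (w : V).
Local Notation s := [:: u, c1 & t].
Hypotheses (us : uniq s) (s3 : (3 <= size s)%N) (ws : w \notin s).
Local Notation f := (star_fun s w).

Lemma star_preim (R : nmodType) (g : V -> R) y : y \in s ->
  \sum_(v | f v == y) g v
    = g (prev s y) + \sum_(v | (v \notin s) && (star_par s w v == y)) g v.
Proof.
move=> ys; rewrite (bigID (mem s)) /=; congr (_ + _).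
  rewrite (big_pred1 (prev s y)) // => v /=; rewrite /star_fun /cycle_fun.
  case: ifPn => vs; last first.
    rewrite andbF; apply/esym; apply: contraNF vs => /eqP->.
    exact: etrans (mem_prev s y) ys.
  rewrite andbT; apply/eqP/eqP => [<-|->]; first exact/esym/(prev_next us).
  exact: (next_prev us).
apply: eq_bigl => v; rewrite /star_fun /cycle_fun andbC.
by case: (v \in s).
Qed.

Lemma star_leaves (R : nmodType) (g : V -> R) y :
  \sum_(v | (v \notin s) && (star_par s w v == y)) g v
    = (if y == c1 then g w else 0)
      + (if y == u then \sum_(v | (v \notin s) && (v != w)) g v else 0).
Proof.
have c1u : (c1 == u) = false.
  by move: us; rewrite /= inE negb_or eq_sym => /andP[/andP[/negPf->]].
rewrite (bigID (pred1 w)) /=; congr (_ + _).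
  case: eqVneq => [->|yc1].
    rewrite (big_pred1 w) // => v /=; case: (eqVneq v w) => [->|]; rewrite ?andbF //.
    by rewrite ws /star_par eqxx /= eqxx.
  rewrite big1 // => v /andP[/andP[_ /eqP vy] /eqP vw].
  by case/eqP: yc1; rewrite -vy vw /star_par eqxx.
case: eqVneq => [->|yu].
  apply: eq_bigl => v; rewrite /star_par; case: (eqVneq v w) => _ /=; rewrite ?andbF //.
  by rewrite eqxx !andbT.
rewrite big1 // => v /andP[/andP[_ /eqP vy] /negPf vw].
by case/eqP: yu; rewrite -vy /star_par vw.
Qed.

Lemma card_star_leaves :
  #|[pred v | (v \notin s) && (v != w)]| = (#|V| - size s - 1)%N.
Proof.
have := cardC (mem (w :: s)); rewrite (card_uniqP _) /= ?ws //.
have -> : #|predC (mem (w :: s))| = #|[pred v | (v \notin s) && (v != w)]|.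
  by apply: eq_card => v; rewrite !inE !negb_or andbC.
by move=> <- /=; lia.
Qed.

Lemma mu_star_lt (R : realType) (m : nat) (c : R) : (2 <= m)%N ->
  (size s + 7 <= #|V|)%N -> 0 < c ->
  c ^+ 2 = m%:R * c + (m%:R - 1) * (#|V|%:R - (size s)%:R + 1) ->
  mu R m (power_hypergraph m (fun_graph f)) < c.
Proof.
move=> hm hV c_gt0 cE; pose n : R := m%:R - 1; pose N : R := #|V|%:R - (size s)%:R + 1.
have n1 : 1 <= n by rewrite /n lerBrDr -[1 + 1]/2%:R ler_nat.
have N8 : 8 <= N.
  by rewrite /N -(subnK hV) !natrD; have := ler0n R (#|V| - (size s + 7)); lra.
have cE' : c ^+ 2 = (n + 1) * c + n * N by rewrite /n subrK.
have aE : (m - 2)%:R = n - 1 :> R by rewrite natrB // /n; ring.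
(* The hub has two cycle neighbours besides these N-2 leaves. *)
have NE : (#|V| - size s - 1)%:R = N - 2 :> R.
  rewrite /N; move: (#|V|) (size s) hV => p q hV.
  rewrite -subnDA natrB ?natrD; last by lia.
  ring.
move: NE N8 cE' aE n1; move: N n => N n NE N8 cE' aE n1.
have nN : 8 * n <= n * N by rewrite mulrC ler_pM2l //; lra.
have c_big : n + 1 < c.
  rewrite -subr_gt0 -(pmulr_rgt0 _ c_gt0).
  have -> : c * (c - (n + 1)) = n * N by rewrite mulrBr -expr2 cE'; ring.
  lra.
have [t1 [t2 [t1_gt0 t2_gt0 hub_lt c1_lt leaf_lt]]] := star_weights n1 N8 c_gt0 cE'.
have thE : c * (c + 1 - (n - 1)) = n * N + 3 * c.
  have -> : c * (c + 1 - (n - 1)) = c ^+ 2 - (n - 2) * c by ring.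
  by rewrite cE'; ring.
have fns : no_short_cycle f by apply: star_no_short.
pose x (v : V) : R :=
  if v == u then 1 else if (v \in s) || (v == w) then t1 else t2.
have x_gt0 v : 0 < x v by rewrite /x; do !case: ifP.
have xu : x u = 1 by rewrite /x eqxx.
have x_cycle v : v \in s -> v != u -> x v = t1.
  by rewrite /x => -> /negPf->.
have wu : w != u by apply: contraNneq ws => ->; rewrite mem_head.
have xw : x w = t1 by rewrite /x (negPf wu) eqxx orbT.
have x_leaf v : v \notin s -> v != w -> x v = t2.
  move=> vs vw; rewrite /x (negPf vs) (negPf vw) /=.
  by case: eqVneq vs => // ->; rewrite mem_head.
have c1s : c1 \in s by rewrite !inE eqxx orbT.
have c1u : c1 != u by move: us; rewrite /= inE negb_or eq_sym => /andP[/andP[]].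
have next_u : next s u = c1 by rewrite /= eqxx.
have next_c1 : next s c1 != u.
  by have [_] := next_neq us s3 (mem_head u (c1 :: t)); rewrite next_u.
have prev_c1 : prev s c1 = u := etrans (congr1 _ (esym next_u)) (prev_next us u).
apply: (@mu_power_lt R m (fun_graph f) hm
  (fun_graph_uniform (G := fun_graph f) fns erefl) c x u) => //.
  by rewrite aE; lra.
move=> y; rewrite (graph_row_fun (G := fun_graph f) _ _ _ _ fns erefl) aE thE /fun_row.
have c1_mul k : 0 <= k -> c + 1 < t1 * (n * N + c - 3 * n + 1 + k).
  by move=> k0; apply: (lt_le_trans c1_lt); rewrite ler_pM2l // lerDl.
case: (boolP (y \in s)) => ys.
  have fy : f y = next s y by rewrite /star_fun /cycle_fun ys.
  rewrite star_preim // star_leaves fy.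
  case: (eqVneq y u) ys => [->|yu] ys.
    rewrite eq_sym (negPf c1u) add0r next_u xu (x_cycle c1) //.
    rewrite (x_cycle (prev s u)) ?mem_prev //; last first.
      have [+ _] := next_neq us s3 (etrans (mem_prev s u) ys).
      by rewrite next_prev // eq_sym.
    rewrite (eq_bigr (fun=> n - 1 + (c + 1) * t2)) => [|v /andP[vs vw]]; last first.
      by rewrite mulr1 x_leaf.
    rewrite sumr_const card_star_leaves -[_ *+ _]mulr_natl.
    rewrite NE; lra.
  rewrite addr0 (x_cycle y) //.
  case: (eqVneq y c1) => [->|yc1].
    rewrite prev_c1 xu xw (x_cycle (next s c1)) ?mem_next //; lra.
  rewrite addr0 (x_cycle (prev s y)) ?mem_prev //; last first.
    apply: contra yc1 => /eqP pu; apply/eqP.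
    exact: etrans (esym (next_prev us y)) (etrans (congr1 (next s) pu) next_u).
  (* Compared with [c1], one neighbour of value [t1] is missing, which frees (n-1) t1 + (c+1) t1 =
     (c+n) t1. *)
  have := c1_mul (c + n) ltac:(lra).
  case: (eqVneq (next s y) u) => [->|nu]; first by rewrite xu; lra.
  rewrite (x_cycle (next s y)) ?mem_next // => _.
  have : 0 < t1 * (n * N + c - 2 * n) by rewrite mulr_gt0 //; lra.
  lra.
have f_s v : f v \in s.
  rewrite /star_fun /cycle_fun; case: ifPn => // vs; first by rewrite mem_next.
  by rewrite /star_par; case: eqP; rewrite //= !inE eqxx.
rewrite big_pred0 => [|v]; last by apply: contraNF ys => /eqP <-.
rewrite add0r /f /cycle_fun /star_fun /cycle_fun (negPf ys) /star_par.
case: (eqVneq y w) => [->|yw] /=.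
  rewrite xw (x_cycle c1) //.
  have : 0 < t1 * (n * N + 2 * c - n) by rewrite mulr_gt0 //; lra.
  lra.
rewrite xu x_leaf //; lra.
Qed.

End Star.

(** * Comparison *)

Lemma star_UC (m l : nat) (V : finType) (s : seq V) (w : V) : (2 <= m)%N ->
  uniq s -> size s = l -> (3 <= l)%N -> w \notin s ->
  hiso (UC m l [:: (#|V| - l - 1)%N; 1%N]) (power_hypergraph m (fun_graph (star_fun s w))).
Proof.
move=> hm us sl l3 ws; have s3 : (3 <= size s)%N by rewrite sl.
apply: (UC_iso (v0 := w) hm us sl) => [v vs|i il|].
- by rewrite mem_nth // (leq_ltn_trans (leq_b1 _)) // (leq_trans _ s3).
- case: s us s3 ws sl => [|u [|c1 t]] // us s3 ws sl.
  have parE v : v \notin [:: u, c1 & t] ->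
      star_par [:: u, c1 & t] w v = nth w [:: u, c1 & t] (v == w).
    by rewrite /star_par; case: (v == w).
  have nthE v : v \notin [:: u, c1 & t] ->
      (star_par [:: u, c1 & t] w v == nth w [:: u, c1 & t] i) = (i == (v == w) :> nat).
    by move=> vs; rewrite parE // nth_uniq ?sl // ?[RHS]eq_sym //; case: (v == w); lia.
  rewrite (eq_card (B := [pred v | (v \notin [:: u, c1 & t]) && (i == (v == w) :> nat)]));
    last first.
    by move=> v; rewrite !inE -!in_cons; case: (boolP (v \in _)) => //= /nthE->.
  case: i {il nthE} => [|[|i]] /=.
  + rewrite -sl -(card_star_leaves us s3 ws); apply: eq_card => v; rewrite !inE.
    by case: (v == w).
  + apply: (etrans _ (card1 w)); apply: eq_card => v; rewrite [LHS]inE [RHS]inE.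
    by case: (eqVneq v w) => [->|]; rewrite ?ws ?andbF.
  + rewrite nth_nil; apply: eq_card0 => v; rewrite [LHS]inE.
    by case: (v == w); rewrite andbF.
by apply: star_no_short.
Qed.

Lemma hub_UC (m l : nat) (V : finType) (s : seq V) (par : V -> V) (v0 : V) :
  (2 <= m)%N -> uniq s -> size s = l -> (3 <= l)%N -> no_short_cycle (cycle_fun s par) ->
  (forall v, v \notin s -> par v = nth v0 s 0) ->
  hiso (UC m l [:: (#|V| - l)%N]) (power_hypergraph m (fun_graph (cycle_fun s par))).
Proof.
move=> hm us sl l3 fns par0; apply: (UC_iso (v0 := v0) hm us sl) => [v vs|i il|] //.
  by rewrite par0 // mem_nth // sl (leq_trans _ l3).
have nthE v : v \notin s -> (par v == nth v0 s i) = (i == 0)%N.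
  by move=> vs; rewrite par0 // nth_uniq ?sl // 1?eq_sym //; lia.
rewrite (eq_card (B := [pred v | (v \notin s) && (i == 0)%N])); last first.
  by move=> v; rewrite !inE; case: (boolP (v \in s)) => //= /nthE->.
case: i {il nthE} => [|i] /=; last first.
  by rewrite nth_nil; apply: eq_card0 => v; rewrite [LHS]inE andbF.
have := cardC (mem s); rewrite (card_uniqP us) sl => <-.
by rewrite addKn; apply: eq_card => v; rewrite [LHS]inE andbT.
Qed.

Lemma hiso_card_edges (H H' : hypergraph) : hiso H H' -> #|edges H| = #|edges H'|.
Proof. by move=> [f /bij_inj/imset_inj finj <-]; rewrite card_imset. Qed.

Lemma card_power_fun_edges m (V : finType) (f : V -> V) : no_short_cycle f ->
  #|edges (power_hypergraph m (fun_graph f))| = #|V|.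
Proof.
move=> fns; rewrite (power_fun_edges m (G := fun_graph f) erefl) card_imset //.
move=> u v /power_edge_inj/(congr1 val) /=.
exact: (fun_edge_inj (G := fun_graph f) fns).
Qed.

(** If everything off the cycle hung at one cycle vertex, rotating that vertex to the front would
    exhibit the excluded hypergraph. *)
Lemma unicyclic_not_hub (m k l : nat) (V : finType) (s : seq V) (par : V -> V) d :
  (2 <= m)%N -> uniq s -> size s = l -> (3 <= l)%N ->
  (forall v, v \notin s -> (d (par v) < d v)%N) -> #|V| = k ->
  ~ hiso (power_hypergraph m (fun_graph (cycle_fun s par))) (UC m l [:: (k - l)%N]) ->
  forall u, u \in s -> exists2 w, w \notin s & par w != u.
Proof.
move=> hm us sl l3 dec kE not_hub u u_s.
case: (boolP [exists w, (w \notin s) && (par w != u)]) => [/existsP[w /andP[]]|].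
  by exists w.
move=> /existsPn all_u; case: not_hub; have [n t st] := rot_to u_s.
have rot_cycle : same_graph (cycle_fun s par) (cycle_fun (rot n s) par).
  by apply: same_graph_ext => v; rewrite cycle_fun_rot.
rewrite (fun_graphE (G := fun_graph (cycle_fun s par)) rot_cycle) -kE.
apply/hiso_sym/(hub_UC (v0 := u)); rewrite ?rot_uniq ?size_rot //.
  by apply: (cycle_fun_no_short (d := d)); rewrite ?rot_uniq ?size_rot ?sl // => v;
    rewrite mem_rot; apply: dec.
move=> v; rewrite mem_rot st /= => vs.
by have := all_u v; rewrite vs negbK => /eqP.
Qed.

(* The Perron vector of the power of [cycle_fun s par] is a test vector for an
   improved star. *)
Lemma mu_unicyclic_le (R : realType) (m l : nat) (V : finType) (s : seq V)
    (par : V -> V) d : (2 <= m)%N -> uniq s -> size s = l -> (3 <= l)%N ->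
  (forall v, v \notin s -> (d (par v) < d v)%N) ->
  let P f := power_hypergraph m (fun_graph f) in
  hconnected (P (cycle_fun s par)) ->
  (forall u, u \in s -> exists2 w, w \notin s & par w != u) ->
  exists (s' : seq V) (w : V), [/\ uniq s', size s' = l, w \notin s',
    mu R m (P (cycle_fun s par)) <= mu R m (P (star_fun s' w)) &
    mu R m (P (star_fun s' w)) = mu R m (P (cycle_fun s par)) ->
      fun_graph (cycle_fun s par) = fun_graph (star_fun s' w)].
Proof.
move=> hm us sl l3 dec P Pconn not_hub; set f := cycle_fun s par.
have s3 : (3 <= size s)%N by rewrite sl.
have fns : no_short_cycle f := cycle_fun_no_short us s3 dec.
have v0 : V by case: (s) s3 => // v.
have [[z [z_ge0 z_neq0 zE]] _] := mu_spectrum R hm (inl v0 : P f).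
have z_gt0 := connected_eigen_gt0 Pconn z_ge0 z_neq0 zE.
have E0 : edges (fun_graph f) != set0.
  by apply/set0Pn; exists [set v0; f v0]; apply: fun_edge_in.
have [c_gt0 b_gt0 rowE] :=
  power_eigen_graph (fun_graph_uniform (G := fun_graph f) fns erefl) E0 z_gt0 zE.
set c := mu R m (P f) in zE c_gt0 b_gt0 rowE *.
pose x (v : V) : R := z (inl v).
have c1_gt0 : 0 < c + 1 by rewrite addr_gt0.
have [s' [w [us' sl' ws' form_le strict]]] := improve_unicyclic
  (ler0n R (m - 2)) c1_gt0 (fun v => z_gt0 (inl v) : 0 < x v) us s3 dec not_hub.
have s'3 : (3 <= size s')%N by rewrite sl'.
have gns : no_short_cycle (star_fun s' w) := star_no_short w us' s'3.
have frow u : fun_row (m - 2)%:R (c + 1) f x u = c * (c + 1 - (m - 2)%:R) * x u.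
  by rewrite -(graph_row_fun (G := fun_graph f) _ _ _ _ fns erefl) -rowE.
have fform : fun_form (m - 2)%:R (c + 1) f x
    = c * (c + 1 - (m - 2)%:R) * \sum_u x u ^+ 2.
  rewrite -fun_formE mulr_sumr; apply: eq_bigr => u _.
  by rewrite frow mulrCA -expr2.
have grow u : @graph_row R m (fun_graph (star_fun s' w)) c x u
    = fun_row (m - 2)%:R (c + 1) (star_fun s' w) x u.
  exact: (graph_row_fun (G := fun_graph (star_fun s' w)) _ _ _ _ gns erefl).
have gform : \sum_u x u * @graph_row R m (fun_graph (star_fun s' w)) c x u
    = fun_form (m - 2)%:R (c + 1) (star_fun s' w) x.
  by rewrite -fun_formE; apply: eq_bigr => u _; rewrite grow.
have [|||le_c eq_c] := @mu_power_ge R m (fun_graph (star_fun s' w)) hm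
  (fun_graph_uniform (G := fun_graph (star_fun s' w)) gns erefl) c x.
- exact: b_gt0.
- by exists v0; rewrite gt_eqF // z_gt0.
- by rewrite gform -fform.
exists s', w; split; rewrite -?sl //.
(* Equal spectral radii make [x] solve the equations of both graphs, which rules out a strict gain
   in the form or in a row. *)
move=> /eq_c rows.
have grow' u : fun_row (m - 2)%:R (c + 1) (star_fun s' w) x u
    = fun_row (m - 2)%:R (c + 1) f x u by rewrite -grow rows frow.
case: strict => [|[y]|same].
- rewrite -!fun_formE ltNge; case/negP.
  by rewrite le_eqVlt; apply/orP; left; apply/eqP; apply: eq_bigr => u _; rewrite grow'.
- by rewrite grow' ltxx.
- exact: (fun_graphE (G := fun_graph f) same).
Qed.

Theorem theorem3p2p1 (R : realType) (m k l : nat) (H : hypergraph)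
    (hm : (2 <= m)%N)
    (hpower : is_power_hypergraph m H)
    (huni : huniform m H)
    (hconn : hconnected H)
    (hcyc : unicyclic H)
    (hlen : exists C : {set {set H}}, loose_cycle_of l C)
    (hk : #|edges H| = k)
    (hbound : 20 <= (k%:Z - l%:Z - 6) * (m%:Z - 1)) :
  (~ hiso H (UC m l [:: (k - l)%N]) ->
     lambda1 R m H <= lambda1 R m (UC m l [:: (k - l - 1)%N; 1%N]) /\
     (lambda1 R m H = lambda1 R m (UC m l [:: (k - l - 1)%N; 1%N]) ->
        hiso H (UC m l [:: (k - l - 1)%N; 1%N]))) /\
  lambda1 R m (UC m l [:: (k - l - 1)%N; 1%N]) <
    (m%:R + Num.sqrt (m%:R ^+ 2 + 4 * (k%:R - l%:R + 1) * (m%:R - 1)))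
      / (2 * m%:R - 2).
Proof.
have [V [s [par [d [us sl l3 dec HP]]]]] := unicyclic_power_fun hpower hconn hcyc hlen.
have s3 : (3 <= size s)%N by rewrite sl.
pose P f := power_hypergraph m (@fun_graph V f).
have fns : no_short_cycle (cycle_fun s par) := cycle_fun_no_short us s3 dec.
have kV : #|V| = k by rewrite -hk (hiso_card_edges HP) card_power_fun_edges.
have kl : (l + 7 <= k)%N.
  rewrite leqNgt; apply/negP => kl7.
  have : (k%:Z - l%:Z - 6) * (m%:Z - 1) <= 0.
    by apply: mulr_le0_ge0; lia.
  by move/(le_trans hbound).
have starP s' w : uniq s' -> size s' = l -> w \notin s' ->
    hiso (UC m l [:: (k - l - 1)%N; 1%N]) (P (star_fun s' w)).
  by move=> us' sl' ws'; rewrite -kV; apply: star_UC.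
have [v0 v0s] : exists v, v \in s.
  by case: (s) s3 => // v t _; exists v; rewrite mem_head.
have m1 : 0 < m%:R - 1 :> R := m1_gt0 R hm.
have lambda_le (H1 H2 : hypergraph) :
    mu R m H1 <= mu R m H2 -> lambda1 R m H1 <= lambda1 R m H2.
  by rewrite ler_pM2l.
split=> [not_hub|].
  have [x0 _] : exists x : H, true by have [f [g _ _] _] := HP; exists (g (inl v0)).
  have lamH := lambda1_iso R hm x0 HP.
  have not_hub' : ~ hiso (P (cycle_fun s par)) (UC m l [:: (k - l)%N]).
    by move=> /(hiso_trans HP).
  have [s' [w [us' sl' ws' le_mu eq_mu]]] :=
    mu_unicyclic_le R hm us sl l3 dec (hconnected_iso HP hconn)
      (unicyclic_not_hub hm us sl l3 dec kV not_hub').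
  have UP := starP s' w us' sl' ws'.
  rewrite lamH -(lambda1_iso R hm (inl v0 : P _) (hiso_sym UP)).
  split=> [|lamE]; first exact: lambda_le.
  apply: hiso_trans HP _; rewrite eq_mu; first exact: hiso_sym.
  by rewrite /mu lamE.
(* Any vertex off the cycle serves as the exceptional one: the star on [s] realises the extremal
   hypergraph whatever the shape of [H]. *)
have [w ws] : exists w, w \notin s.
  apply/existsP; apply: contraT; rewrite negb_exists => /forallP all_s.
  have : (#|V| <= size s)%N.
    rewrite -(card_uniqP us); apply/subset_leq_card/subsetP => v _.
    by have := all_s v; rewrite negbK.
  by rewrite kV sl; lia.
rewrite -(lambda1_iso R hm (inl v0 : P _) (hiso_sym (starP s w us sl ws))).
set D := Num.sqrt _.
(* [c] is m-1 times the claimed bound, and D^2 is the discriminant of its quadratic equation. *)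
pose c : R := (m%:R + D) / 2.
have m0 : 0 < m%:R :> R by rewrite ltr0n; lia.
have D_ge0 : 0 <= D by apply: sqrtr_ge0.
have kl_ge : 0 <= k%:R - l%:R + 1 :> R.
  by rewrite addr_ge0 // subr_ge0 ler_nat; lia.
have DE : D ^+ 2 = m%:R ^+ 2 + 4 * (k%:R - l%:R + 1) * (m%:R - 1).
  by rewrite sqr_sqrtr // addr_ge0 ?sqr_ge0 // !mulr_ge0 // ltW.
have c_gt0 : 0 < c by rewrite divr_gt0 // ltr_wpDr.
have cE : c ^+ 2 = m%:R * c + (m%:R - 1) * (#|V|%:R - (size s)%:R + 1).
  rewrite kV sl /c; have -> : ((m%:R + D) / 2) ^+ 2 =
    (D ^+ 2 + 2 * m%:R * D + m%:R ^+ 2) / 4 :> R by field.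
  by rewrite DE; field.
have hV : (size s + 7 <= #|V|)%N by rewrite kV sl.
have mu_lt : mu R m (P (star_fun s w)) < c.
  case: s {starP HP fns v0s dec sl} us s3 ws hV cE => [|u [|c1 t]] // us s3 ws hV cE.
  exact: mu_star_lt.
rewrite -(ltr_pM2l m1); apply: (lt_le_trans mu_lt).
rewrite le_eqVlt; apply/orP; left; apply/eqP; rewrite /c.
field.
have -> : 2 * m%:R - 2 = 2 * (m%:R - 1) :> R by ring.
by rewrite mulf_neq0 ?gt_eqF.
Qed.
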